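(* Let $\beta=\frac12+\frac{\log(5/3)}{\log 4}$ and $m\ge 0$. The trace map $T_m$ (restriction to $\mathrm{SG}_m$) is continuous from $\mathrm{dom}\,\mathcal{E}$ to $H^\beta(\mathrm{SG}_m)$, with $$\|T_mF\|_{H^\beta(\mathrm{SG}_m)}^2\le c\,\mathcal{E}(F)$$ for all $F\in\mathrm{dom}\,\mathcal{E}$. Moreover, there exists a continuous linear extension map $E_m:H^\beta(\mathrm{SG}_m)\to\mathrm{dom}\,\mathcal{E}$ with $T_mE_mf=f$ and $$\mathcal{E}(E_mf)\le c\,\|f\|_{H^\beta(\mathrm{SG}_m)}^2$$ for all $f\in H^\beta(\mathrm{SG}_m)$. Here $c$ is a constant independent of $F$ and $f$.
   Context: Let $q_0,q_1,q_2$ be the vertices of an equilateral triangle of side length $1$ in the plane, and $\Phi_i(x)=\frac12x+\frac12q_i$. The Sierpinski gasket $\mathrm{SG}$ is the unique nonempty compact set with $\mathrm{SG}=\bigcup_{i=0}^2\Phi_i(\mathrm{SG})$. For a word $w=(w_1,\dots,w_m)\in\{0,1,2\}^m$ write $|w|=m$ and $\Phi_w=\Phi_{w_1}\circ\cdots\circ\Phi_{w_m}$. For a function $f$ on $\mathrm{SG}$ let $E_m(f)=\sum_{i\ne j}\sum_{|w|=m}|f(\Phi_wq_i)-f(\Phi_wq_j)|^2$ and $\mathcal{E}(f)=\lim_{m\to\infty}(5/3)^mE_m(f)$ (the sequence is nondecreasing); $\mathrm{dom}\,\mathcal{E}$ is the space of functions (continuous on $\mathrm{SG}$) for which this limit is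 finite. $\mathrm{SG}_m$ is the metric graph whose vertices are the points $\Phi_wq_i$ ($|w|=m$, $i=0,1,2$) and whose edges are the segments $\Phi_w(e_{ij})$, $|w|=m$, where $e_{ij}$ is the side of the original triangle joining $q_i$ and $q_j$; each edge has length $2^{-m}$ (equivalently $\mathrm{SG}_m=\mathrm{SG}\cap$ the triangular grid of side $2^{-m}$). For a metric graph $G$ with edges $e$ of length $L_e$ parametrized by arclength $x\mapsto e(x)$, $H^\beta(G)$ is the space of continuous functions $F$ on $G$ (modulo constants) with $$\|F\|_{H^\beta(G)}^2=\sum_{e}\int_0^{L_e}\int_0^{L_e}\frac{|F(e(x))-F(e(y))|^2}{|x-y|^{1+2\beta}}\,dx\,dy<\infty.$$ *)

(* Defs.v *)
From HB Require Import structures.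
From mathcomp Require Import all_boot all_order all_algebra.
From mathcomp Require Import all_classical all_reals all_analysis.
Set Implicit Arguments. Unset Strict Implicit. Unset Printing Implicit Defensive.
Import Order.TTheory GRing.Theory Num.Theory.
Import numFieldNormedType.Exports.
Local Open Scope classical_set_scope.
Local Open Scope ring_scope.

Section SG.
Variable R : realType.
Notation pt := 'rV[R]_2.

Definition eucl_dist (p p' : pt) : R :=
  Num.sqrt ((p ord0 ord0 - p' ord0 ord0) ^+ 2 + (p ord0 ord_max - p' ord0 ord_max) ^+ 2).

Variable q : 'I_3 -> pt.

Definition Phi (i : 'I_3) (x : pt) : pt := 2^-1 *: x + 2^-1 *: q i.

Definition Phiw (w : seq 'I_3) : pt -> pt := foldr (fun i g => Phi i \o g) id w.

Definition Em (m : nat) (f : pt -> R) : R :=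
  \sum_(w : m.-tuple 'I_3) \sum_(i : 'I_3) \sum_(j : 'I_3 | i != j)
     (f (Phiw w (q i)) - f (Phiw w (q j))) ^+ 2.

Definition energy (f : pt -> R) : \bar R :=
  limn (fun m => (((5 / 3 : R) ^+ m) * Em m f)%:E).

(* dom E, for functions on the set K = SG *)
Definition in_dom (K : set pt) (f : pt -> R) : Prop :=
  {within K, continuous f} /\ (energy f < +oo)%E.

Definition Ledge (m : nat) : R := (2 : R) ^- m.

(* arclength parametrization of the edge Phi_w(e_ij), x in [0, 2^-|w|] *)
Definition edge (w : seq 'I_3) (i j : 'I_3) (x : R) : pt :=
  Phiw w (q i + (x / Ledge (size w)) *: (q j - q i)).

Definition SGm (m : nat) : set pt :=
  [set p | exists (w : m.-tuple 'I_3) (i j : 'I_3) (x : R),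
      0 <= x <= Ledge m /\ p = edge w i j x].

Definition beta : R := 2^-1 + ln (5 / 3) / ln 4.

(* squared H^beta(SG_m) seminorm: sum over the edges Phi_w(e_ij), i < j *)
Definition hnorm (m : nat) (f : pt -> R) : \bar R :=
  (\sum_(w : m.-tuple 'I_3) \sum_(i : 'I_3) \sum_(j : 'I_3 | (i < j)%N)
    \int[@lebesgue_measure R]_(x in `[0%R, Ledge m]%classic)
      \int[@lebesgue_measure R]_(y in `[0%R, Ledge m]%classic)
        ((f (edge w i j x) - f (edge w i j y)) ^+ 2
           / (`|x - y| `^ (1 + 2 * beta)))%:E)%E.

Definition inH (m : nat) (f : pt -> R) : Prop :=
  {within SGm m, continuous f} /\ (hnorm m f < +oo)%E.

End SG.

(* Main.v *)
Require Import Defs.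
From HB Require Import structures.
From mathcomp Require Import all_boot all_order all_algebra.
From mathcomp Require Import all_classical all_reals all_analysis.
From mathcomp Require Import measurable_realfun ring lra zify.
Import Order.TTheory GRing.Theory Num.Theory.
Import numFieldNormedType.Exports.
Local Open Scope classical_set_scope.
Local Open Scope ring_scope.

(** Let delta(n, k) be the increment of a function over the k-th of the 2^n dyadic
    pieces of an edge.  Since 2^(2 beta - 1) = 5/3, the H^beta seminorm on the edge is
    equivalent to the sum over n of (5/3)^n sum_k delta(n, k)^2; for the lower bound
    the point values are reached from means over dyadic intervals, whose differences
    at scale n only involve pairs of points separated exactly at that scale.

    Trace.  Passing to the next level, the energy gain of a cell controls the squared
    deviation from the harmonic values at the new vertices, and for harmonic functions
    the quadratic form D^2 + s^2/2 (D the difference along a side, s the asymmetry of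
    the opposite corner) of the two cells on a side, multiplied by 5/3, contracts.
    So sum_n (5/3)^n sum_k delta(n, k)^2 is bounded by the total energy gain.

    Extension.  New vertices on the edges take the prescribed values and all others
    the harmonic ones.  The gain of a cell touching an edge is then bounded by the
    increments and the asymmetry there, the latter again contracts from one level
    to the next, and cells not touching an edge have no gain.  Finite energy makes the
    vertex values Hoelder continuous, so they extend to the whole gasket. *)

(** * Discrete estimates on dyadic grids *)

(** Increments along a side obey no closed recursion, because the harmonic value at a midpoint also
    involves the opposite corner. The asymmetry is the one extra quantity that closes it, and its
    weight 1/2 is chosen so that the factor 5/3 per level still leaves a contraction; the room that
    remains pays for cross terms with the deviations. Every multiscale estimate has the same form: a
    nonnegative [T n] passes from one level to the next with a factor below 1 and an error [a n], so
    the sum of the [T n] is bounded by the sum of the [a n], up to an initial term when the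
    recursion runs forwards. The double integral is only compared with finite sums: from above by
    step majorants and Fatou's lemma, from below by a step minorant. Measurability of the singular
    kernel is never at issue. Of the gasket only compactness, nonemptiness and self-similarity are
    given. That its cells meet only in vertices, which makes the limit of vertex values independent
    of the address, is derived from barycentric coordinates. *)

Lemma sum_double (V : nmodType) n (h : nat -> V) :
  \sum_(k < n.*2) h k = \sum_(k < n) (h k.*2 + h k.*2.+1).
Proof.
elim: n => [|n IH]; first by rewrite !big_ord0.
by rewrite doubleS !big_ord_recr /= IH addrA.
Qed.

Lemma sum_divn (R : pzSemiRingType) n r (h : nat -> R) :
  \sum_(k < n * 2 ^ r) h (k %/ 2 ^ r)%N = 2 ^+ r * \sum_(k < n) h k.
Proof.
elim: n => [|n IH]; first by rewrite mul0n !big_ord0 mulr0.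
rewrite mulSn addnC big_split_ord /= IH big_ord_recr /= mulrDr; congr (_ + _).
rewrite (eq_bigr (fun=> h n)); last first.
  by move=> i _; rewrite divnMDl ?expn_gt0// divn_small ?addn0.
by rewrite sumr_const card_ord -[LHS]mulr_natl natrX.
Qed.

Lemma sqrD2_le (R : realDomainType) (a b : R) :
  (a + b) ^+ 2 <= 2 * a ^+ 2 + 2 * b ^+ 2.
Proof.
rewrite -subr_ge0; have -> : 2 * a ^+ 2 + 2 * b ^+ 2 - (a + b) ^+ 2 = (a - b) ^+ 2.
  by ring.
exact: sqr_ge0.
Qed.

Lemma sqrD3_le (R : realDomainType) (a b c : R) :
  (a + b + c) ^+ 2 <= 3 * a ^+ 2 + 3 * b ^+ 2 + 3 * c ^+ 2.
Proof.
have := sqr_ge0 (a - b); have := sqr_ge0 (a - c); have := sqr_ge0 (b - c).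
by rewrite !expr2; nra.
Qed.

(** Summing the recursion and shifting the index lets the left side absorb the [th] term; [T N = 0]
    ensures that the shifted sum is no larger. Here control passes from fine levels to coarse ones,
    in [sum_contract_fwd] from coarse to fine. *)
Lemma sum_contract (R : realFieldType) (N : nat) (th C : R) (T a : nat -> R) :
  0 <= th -> T N = 0 -> (forall n, 0 <= T n) ->
  (forall n, (n < N)%N -> T n <= th * T n.+1 + C * a n) ->
  (1 - th) * \sum_(n < N) T n <= C * \sum_(n < N) a n.
Proof.
move=> th0 TN T0 rec.
have : \sum_(n < N) T n <= \sum_(n < N) (th * T n.+1 + C * a n).
  by apply: ler_sum => i _; exact: rec.
rewrite big_split /= -!mulr_sumr.
have : \sum_(n < N) T n.+1 <= \sum_(n < N) T n.
  case: N TN rec => [|N] TN rec; first by rewrite !big_ord0.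
  rewrite big_ord_recr /= TN addr0 big_ord_recl /=.
  by rewrite ler_wpDl.
move=> /(ler_wpM2l th0) h1 h2; rewrite mulrBl mul1r; lra.
Qed.

Lemma sum_contract_fwd (R : realFieldType) (N : nat) (th C : R) (T a : nat -> R) :
  0 <= th -> (forall n, 0 <= T n) ->
  (forall n, T n.+1 <= th * T n + C * a n) ->
  (1 - th) * \sum_(n < N) T n <= T 0 + C * \sum_(n < N) a n.
Proof.
move=> th0 T0 rec.
have h1 : \sum_(n < N) T n.+1 <= \sum_(n < N) (th * T n + C * a n).
  by apply: ler_sum => i _; exact: rec.
rewrite big_split /= -!mulr_sumr in h1.
have : \sum_(n < N) T n <= T 0 + \sum_(n < N) T n.+1.
  rewrite -(big_ord_recl N (fun i : 'I_N.+1 => T i)) big_ord_recr /=.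
  by rewrite ler_wpDr.
move: h1; rewrite mulrBl mul1r; lra.
Qed.

Definition neighbors (k l : nat) : bool := (k <= l.+1)%N && (l <= k.+1)%N.

(** * Upper bound: a discrete Hardy inequality *)

Section discrete_upper.
Variables (R : realFieldType) (G : nat -> nat -> R).
Hypothesis GS : forall n k, G n k = G n.+1 k.*2.

Let Delta n := \sum_(k < 2 ^ n) (G n k.+1 - G n k) ^+ 2.
Let V n r := \sum_(k < 2 ^ (n + r)) (G (n + r)%N k - G n (k %/ 2 ^ r)%N) ^+ 2.

Let V0 n : V n 0 = 0.
Proof.
rewrite /V addn0; apply: big1 => k _.
by rewrite expn0 divn1 subrr expr0n.
Qed.

(** The value at the level [n.+1] point to the left is inserted. It differs from the level [n] value
    only when its index is odd, and each index serves [2 ^ r] fine points. *)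
Let VS n r : V n r.+1 <= 2 * V n.+1 r + 2 * (2 ^+ r * Delta n.+1).
Proof.
have hV : \sum_(k < 2 ^ (n.+1 + r))
    (G n.+1 (k %/ 2 ^ r)%N - G n.+1 (((k %/ 2 ^ r) %/ 2).*2)%N) ^+ 2
    <= 2 ^+ r * Delta n.+1.
  rewrite expnD (sum_divn _ _ _ (fun k => (G n.+1 k - G n.+1 (k %/ 2).*2) ^+ 2)).
  apply: ler_wpM2l; first exact: exprn_ge0.
  rewrite /Delta expnS mul2n (sum_double _ _ (fun k => (G n.+1 k - G n.+1 (k %/ 2).*2) ^+ 2)).
  rewrite (sum_double _ _ (fun k => (G n.+1 k.+1 - G n.+1 k) ^+ 2)).
  apply: ler_sum => k _.
  rewrite divn2 doubleK subrr expr0n add0r /= divn2 /= uphalf_double.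
  by rewrite ler_wpDr// sqr_ge0.
apply: le_trans (lerD (lexx _) (ler_wpM2l _ hV)) => //.
rewrite /V addnS -addSn !mulr_sumr -big_split /=; apply: ler_sum => k _.
have -> : G n (k %/ 2 ^ r.+1)%N = G n.+1 ((k %/ 2 ^ r) %/ 2).*2.
  by rewrite GS -divnMA -expnSr.
apply: le_trans (sqrD2_le _ _ _).
by rewrite le_eqVlt; apply/orP; left; apply/eqP; congr (_ ^+ 2); ring.
Qed.

(** By [VS] the unweighted [V] may double from one level to the next; this weight turns the factor
    into 2 * 3 / 10 = 3 / 5. *)
Let U n r := (10 / 3) ^+ n * (2 ^- (n + r) * V n r).

Let a n := (5 / 3) ^+ n * Delta n.

Let US n r : U n r.+1 <= 3 / 5 * U n.+1 r + 3 / 5 * a n.+1.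
Proof.
rewrite /U /a.
have k0 : 0 <= (10 / 3 : R) ^+ n * 2 ^- (n + r.+1).
  by rewrite mulr_ge0 ?invr_ge0 ?exprn_ge0//; lra.
have := ler_wpM2l k0 (VS n r).
rewrite -!mulrA => /le_trans; apply.
rewrite le_eqVlt; apply/orP; left; apply/eqP.
have e1 : (10 / 3 : R) ^+ n.+1 = 10 / 3 * (10 / 3) ^+ n by rewrite exprS.
have e2 : (5 / 3 : R) ^+ n.+1 = 5 / 3 * ((10 / 3) ^+ n * 2 ^- n).
  rewrite exprS; congr (_ * _); rewrite -exprVn -exprMn; congr (_ ^+ _).
  by field.
rewrite e1 e2 addSn addnS exprS exprD.
have z1 : (2 : R) ^+ n != 0 by rewrite expf_neq0// pnatr_eq0.
have z2 : (2 : R) ^+ r != 0 by rewrite expf_neq0// pnatr_eq0.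
by field; rewrite z1 z2.
Qed.

Let sumU N : \sum_(n < N) U n (N - n) <= 3 / 2 * \sum_(n < N) a n.+1.
Proof.
have U0 n r : 0 <= U n r.
  apply: mulr_ge0; first by apply: exprn_ge0; lra.
  apply: mulr_ge0; first by rewrite invr_ge0 exprn_ge0.
  by apply: sumr_ge0 => *; exact: sqr_ge0.
have : (1 - 3 / 5) * \sum_(n < N) U n (N - n) <= 3 / 5 * \sum_(n < N) a n.+1.
  apply: (sum_contract _ N _ _ (fun n => U n (N - n)) (fun n => a n.+1)).
  - by lra.
  - by rewrite /U subnn V0 !mulr0.
  - by move=> n; exact: U0.
  - by move=> n nN; rewrite -subnSK// US.
lra.
Qed.

Let sum_near (n k : nat) : \sum_(l < n) (neighbors k l)%:R <= 3 :> R.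
Proof.
have s1 j : \sum_(l < n) (l == j :> nat)%:R <= 1 :> R.
  elim: n => [|p IH]; first by rewrite big_ord0.
  case: (ltnP j p) => pj.
    rewrite big_ord_recr /= gtn_eqF// addr0; exact: IH.
  rewrite big_ord_recr /= big1 ?add0r; first by case: eqP.
  by move=> i _; rewrite ltn_eqF// (leq_trans (ltn_ord i)).
apply: (@le_trans _ _ (\sum_(l < n) ((l == k :> nat)%:R + (l == k.+1 :> nat)%:R + (l == k.-1 :> nat)%:R))).
  apply: ler_sum => l _; rewrite -!natrD ler_nat /neighbors.
  case: (altP (l =P k :> nat)) => h1; case: (altP (l =P k.+1 :> nat)) => h2;
  case: (altP (l =P k.-1 :> nat)) => h3 //=;
  by case: leqP => //=; case: leqP => //=; lia.
rewrite !big_split /=.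
have := s1 k; have := s1 k.+1; have := s1 k.-1; lra.
Qed.

Let near_pairs n :
  \sum_(k < 2 ^ n) \sum_(l < 2 ^ n) (neighbors k l)%:R * (G n k - G n l) ^+ 2
   <= 2 * Delta n.
Proof.
have s1 (k : nat) (b : R) p : 0 <= b -> \sum_(l < p) (l == k :> nat)%:R * b <= b.
  move=> b0; elim: p => [|p IH]; first by rewrite big_ord0.
  case: (ltnP k p) => pj.
    rewrite big_ord_recr /= gtn_eqF// mul0r addr0; exact: IH.
  rewrite big_ord_recr /= big1 ?add0r.
    by case: eqP; rewrite ?mul1r ?mul0r.
  by move=> i _; rewrite ltn_eqF ?mul0r// (leq_trans (ltn_ord i)).
apply: (@le_trans _ _ (\sum_(k < 2 ^ n) \sum_(l < 2 ^ n)
   ((l == k.+1 :> nat)%:R * (G n k.+1 - G n k) ^+ 2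
    + (k == l.+1 :> nat)%:R * (G n l.+1 - G n l) ^+ 2))).
  apply: ler_sum => k _; apply: ler_sum => l _.
  have q1 := sqr_ge0 (G n k.+1 - G n k); have q2 := sqr_ge0 (G n l.+1 - G n l).
  rewrite /neighbors; case: (ltngtP k l) => kl.
  - case: (altP (l =P k.+1 :> nat)) => h1.
      have -> : (k <= l.+1)%N && (l <= k.+1)%N = true by lia.
      by rewrite h1 -sqrrN opprB !mul1r ler_wpDr// mulr_ge0// sqr_ge0.
    have -> : (l <= k.+1)%N = false by lia.
    by rewrite andbF mul0r addr_ge0// mulr_ge0 ?ler0n.
  - case: (altP (k =P l.+1 :> nat)) => h1.
      have -> : (k <= l.+1)%N && (l <= k.+1)%N = true by lia.
      by rewrite h1 !mul1r ler_wpDl// mulr_ge0// sqr_ge0.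
    have -> : (k <= l.+1)%N = false by lia.
    by rewrite mul0r addr_ge0// mulr_ge0 ?ler0n.
  - by rewrite kl subrr expr0n mulr0 addr_ge0// mulr_ge0 ?ler0n.
have -> : 2 * Delta n = Delta n + Delta n by ring.
under eq_bigr do rewrite big_split.
rewrite big_split /= lerD//; first by apply: ler_sum => k _; apply: s1; exact: sqr_ge0.
rewrite exchange_big /=; apply: ler_sum => k _; apply: s1; exact: sqr_ge0.
Qed.

(** A pair that is near at scale [n] is joined through the two coarse points to the left of [k] and
    [l]. At most three neighbours per coarse index and [sqrD3_le] give [18 * U + 6 * a], and [sumU]
    yields 18 * 3 / 2 + 6 = 33. The base 20 / 3 is 2 to the kernel exponent [1 + 2 * beta]. *)
Lemma discrete_upper (N : nat) :
  4 ^- N * (\sum_(k < 2 ^ N) \sum_(l < 2 ^ N) \sum_(n < N.+1)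
    (neighbors (k %/ 2 ^ (N - n)) (l %/ 2 ^ (N - n)))%:R * (20 / 3) ^+ n
    * (G N k - G N l) ^+ 2)
  <= 33 * \sum_(n < N.+1) (5 / 3) ^+ n * \sum_(k < 2 ^ n) (G n k.+1 - G n k) ^+ 2.
Proof.
rewrite -/(\sum_(n < N.+1) a n).
set X := (X in _ * X <= _).
have {X}-> : X = \sum_(n < N.+1) (20 / 3) ^+ n * (\sum_(k < 2 ^ N) \sum_(l < 2 ^ N)
    (neighbors (k %/ 2 ^ (N - n)) (l %/ 2 ^ (N - n)))%:R * (G N k - G N l) ^+ 2).
  rewrite /X; under eq_bigr do rewrite exchange_big.
  rewrite exchange_big /=; apply: eq_bigr => n _.
  rewrite mulr_sumr; apply: eq_bigr => k _; rewrite mulr_sumr; apply: eq_bigr => l _.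
  by ring.
rewrite mulr_sumr.
have key (n : nat) : (n <= N)%N -> 4 ^- N * ((20 / 3) ^+ n *
   (\sum_(k < 2 ^ N) \sum_(l < 2 ^ N)
    (neighbors (k %/ 2 ^ (N - n)) (l %/ 2 ^ (N - n)))%:R * (G N k - G N l) ^+ 2))
   <= 18 * U n (N - n) + 6 * a n.
  move=> nN; have [r Nr] : exists r, N = (n + r)%N by exists (N - n)%N; lia.
  rewrite {N nN}Nr addKn.
  set Y := \sum_(k < _) _.
  have hY : Y <= 18 * 2 ^+ r * V n r + 6 * (2 ^+ r * (2 ^+ r * Delta n)).
    pose nr k l : R := (neighbors (k %/ 2 ^ r) (l %/ 2 ^ r))%:R.
    pose v k := (G (n + r)%N k - G n (k %/ 2 ^ r)%N) ^+ 2.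
    have nr0 k l : 0 <= nr k l by rewrite /nr; case: neighbors.
    have v0 k : 0 <= v k by exact: sqr_ge0.
    apply: (@le_trans _ _ (\sum_(k < 2 ^ (n + r)) \sum_(l < 2 ^ (n + r))
      ((3 * (v k * nr k l) + 3 * (v l * nr l k)) +
       3 * (nr k l * (G n (k %/ 2 ^ r)%N - G n (l %/ 2 ^ r)%N) ^+ 2)))).
      apply: ler_sum => k _; apply: ler_sum => l _.
      have -> : nr l k = nr k l by rewrite /nr /neighbors andbC.
      have := ler_wpM2l (nr0 k l) (sqrD3_le _ (G (n + r)%N k - G n (k %/ 2 ^ r)%N)
        (G n (l %/ 2 ^ r)%N - G (n + r)%N l) (G n (k %/ 2 ^ r)%N - G n (l %/ 2 ^ r)%N)).
      rewrite (_ : _ + _ + _ = G (n + r)%N k - G (n + r)%N l); last by ring.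
      move=> /le_trans; apply.
      rewrite /v -[X in _ + 3 * X + _]sqrrN opprB le_eqVlt; apply/orP; left; apply/eqP.
      by ring.
    have hn k : \sum_(l < 2 ^ (n + r)) nr k l <= 3 * 2 ^+ r.
      rewrite /nr expnD (sum_divn R _ _ (fun l => (neighbors (k %/ 2 ^ r) l)%:R)).
      by rewrite mulrC ler_wpM2r ?exprn_ge0.
    have h1 : \sum_(k < 2 ^ (n + r)) \sum_(l < 2 ^ (n + r)) 3 * (v k * nr k l)
       <= 9 * 2 ^+ r * V n r.
      rewrite /V mulr_sumr; apply: ler_sum => k _; rewrite -!mulr_sumr.
      have := ler_wpM2l (v0 k) (hn k); rewrite /v; lra.
    have h3 : \sum_(k < 2 ^ (n + r)) \sum_(l < 2 ^ (n + r))
         3 * (nr k l * (G n (k %/ 2 ^ r)%N - G n (l %/ 2 ^ r)%N) ^+ 2)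
        <= 6 * (2 ^+ r * (2 ^+ r * Delta n)).
      rewrite /nr.
      rewrite (eq_bigr (fun k : 'I_(2 ^ (n + r)) => (fun k => 3 * (2 ^+ r *
         \sum_(l < 2 ^ n) ((neighbors k l)%:R * (G n k - G n l) ^+ 2))) (k %/ 2 ^ r)%N)); last first.
        move=> k _ /=; move: (nat_of_ord k) => {}k; rewrite -mulr_sumr expnD; congr (_ * _).
        by rewrite (sum_divn R _ _ (fun l => ((neighbors (k %/ 2 ^ r) l)%:R
           * (G n (k %/ 2 ^ r)%N - G n l) ^+ 2))).
      rewrite expnD.
      rewrite (sum_divn R _ _ (fun k => 3 * (2 ^+ r *
         \sum_(l < 2 ^ n) ((neighbors k l)%:R * (G n k - G n l) ^+ 2)))).
      rewrite -!mulr_sumr.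
      have := near_pairs n.
      have p0 : 0 <= (2 ^+ r * 2 ^+ r : R) by rewrite mulr_ge0 ?exprn_ge0.
      move=> /(ler_wpM2l p0); lra.
    rewrite (eq_bigr (fun k : 'I_(2 ^ (n + r)) => \sum_(l < 2 ^ (n + r)) 3 * (v k * nr k l) +
      \sum_(l < 2 ^ (n + r)) 3 * (v l * nr l k) +
      \sum_(l < 2 ^ (n + r))
         3 * (nr k l * (G n (k %/ 2 ^ r)%N - G n (l %/ 2 ^ r)%N) ^+ 2))); last first.
      by move=> k _; rewrite !big_split.
    rewrite !big_split /= [X in _ + X + _]exchange_big /=.
    move: h1 h3; lra.
  have k0 : 0 <= 4 ^- (n + r) * (20 / 3 : R) ^+ n.
    by rewrite mulr_ge0 ?invr_ge0 ?exprn_ge0//; lra.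
  rewrite mulrA; apply: le_trans (ler_wpM2l k0 hY) _.
  rewrite le_eqVlt; apply/orP; left; apply/eqP; rewrite /U /a.
  have e4 j : (4 : R) ^+ j = 2 ^+ j * 2 ^+ j.
    by rewrite -exprMn; congr (_ ^+ _); ring.
  have e1 : (10 / 3 : R) ^+ n = (5 / 3) ^+ n * 2 ^+ n.
    by rewrite -exprMn; congr (_ ^+ _); field.
  have e2 : (20 / 3 : R) ^+ n = (5 / 3) ^+ n * 2 ^+ n * 2 ^+ n.
    by rewrite -!exprMn; congr (_ ^+ _); field.
  rewrite e1 e2 e4 !exprD.
  have z1 : (2 : R) ^+ n != 0 by rewrite expf_neq0// pnatr_eq0.
  have z2 : (2 : R) ^+ r != 0 by rewrite expf_neq0// pnatr_eq0.
  by field; rewrite z1 z2.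
apply: (@le_trans _ _ (\sum_(n < N.+1) (18 * U n (N - n) + 6 * a n))).
  by apply: ler_sum => n _; apply: key; rewrite -ltnS.
rewrite big_split /= -!mulr_sumr big_ord_recr /= subnn {2}/U V0 !mulr0 addr0.
have := sumU N.
have : \sum_(n < N) a n.+1 <= \sum_(n < N.+1) a n.
  rewrite [X in _ <= X]big_ord_recl ler_wpDl//.
  apply: mulr_ge0; first by apply: exprn_ge0; lra.
  by apply: sumr_ge0 => *; exact: sqr_ge0.
lra.
Qed.

End discrete_upper.

Lemma sum_block (V : nmodType) n p (h : nat -> V) :
  \sum_(k < n * p) h k = \sum_(i < n) \sum_(t < p) h (i * p + t)%N.
Proof.
elim: n => [|n IH]; first by rewrite mul0n !big_ord0.
by rewrite mulSn addnC big_split_ord /= IH big_ord_recr.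
Qed.

Lemma sqrD4_le (R : realDomainType) (a b c d : R) :
  (a + b + c + d) ^+ 2 <= 4 * (a ^+ 2 + b ^+ 2 + c ^+ 2 + d ^+ 2).
Proof.
have := sqr_ge0 (a - b); have := sqr_ge0 (c - d); have := sqr_ge0 (a + b - c - d).
have := sqr_ge0 (a + b + c + d).
by rewrite !expr2; nra.
Qed.

(** * Lower bound: block averages and sibling blocks *)

Section discrete_lower.
Variable R : realFieldType.
Implicit Types (g : nat -> R) (A : nat -> nat -> R).

Definition block_avg r g i : R := 2 ^- r * \sum_(t < 2 ^ r) g (i * 2 ^ r + t)%N.

(** The indices lie in different halves of one block of length [2 ^ r.+1]; for given [k] and [l]
    this happens for at most one [r]. *)
Definition split_at r (k l : nat) : bool :=
  (k %/ 2 ^ r %/ 2 == l %/ 2 ^ r %/ 2)%N && (k %/ 2 ^ r != l %/ 2 ^ r)%N.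

Lemma block_avgS r g i :
  block_avg r.+1 g i = (block_avg r g i.*2 + block_avg r g i.*2.+1) / 2.
Proof.
rewrite /block_avg expnS mul2n -addnn big_split_ord /=.
have -> : \sum_(i0 < 2 ^ r) g (i * (2 ^ r + 2 ^ r) + i0)%N =
          \sum_(t < 2 ^ r) g (i.*2 * 2 ^ r + t)%N.
  by apply: eq_bigr => t _; congr g; lia.
have -> : \sum_(i0 < 2 ^ r) g (i * (2 ^ r + 2 ^ r) + (2 ^ r + i0))%N =
          \sum_(t < 2 ^ r) g (i.*2.+1 * 2 ^ r + t)%N.
  by apply: eq_bigr => t _; congr g; lia.
rewrite exprS invfM; lra.
Qed.

(* Cauchy-Schwarz in the form [(a - b) ^+ 2 >= 2 c (a - b) - c ^+ 2]. *)
Lemma sqr_avg_le r g i j :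
  (block_avg r g i - block_avg r g j) ^+ 2 <=
  4 ^- r * \sum_(s < 2 ^ r) \sum_(t < 2 ^ r)
     (g (i * 2 ^ r + s)%N - g (j * 2 ^ r + t)%N) ^+ 2.
Proof.
set c := block_avg r g i - block_avg r g j.
have e4 : (4 : R) ^+ r = 2 ^+ r * 2 ^+ r.
  by rewrite -exprMn; congr (_ ^+ _); ring.
have z2 : (2 : R) ^+ r != 0 by rewrite expf_neq0// pnatr_eq0.
have p4 : 0 < (4 : R) ^+ r by rewrite exprn_gt0.
rewrite -ler_pdivrMl ?invr_gt0// invrK.
apply: (@le_trans _ _ (\sum_(s < 2 ^ r) \sum_(t < 2 ^ r)
   (2 * c * (g (i * 2 ^ r + s)%N - g (j * 2 ^ r + t)%N) - c ^+ 2))); last first.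
  apply: ler_sum => s _; apply: ler_sum => t _.
  rewrite -subr_ge0; set x := g _ - g _.
  rewrite (_ : _ - _ = (x - c) ^+ 2) ?sqr_ge0//; ring.
under eq_bigr do rewrite sumrB -mulr_sumr sumrB !sumr_const !card_ord.
rewrite sumrB -mulr_sumr sumrB sumr_const card_ord.
rewrite -[X in _ <= _ * X - _]/(_ - _) sumr_const card_ord.
have -> : \sum_(t < 2 ^ r) g (j * 2 ^ r + t)%N = 2 ^+ r * block_avg r g j.
  by rewrite /block_avg mulVKf.
have -> : \sum_(i0 < 2 ^ r) g (i * 2 ^ r + i0)%N *+ 2 ^ r
     = 2 ^+ r * (2 ^+ r * block_avg r g i).
  by rewrite /block_avg mulVKf// sumrMnl -[LHS]mulr_natl natrX.
have mn (x : R) : x *+ (2 ^ r) = 2 ^+ r * x by rewrite -[LHS]mulr_natl natrX.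
rewrite !mn e4 -/c.
rewrite le_eqVlt; apply/orP; left; apply/eqP; rewrite /c; ring.
Qed.

Lemma split_energy n r g :
  \sum_(i < 2 ^ n) (block_avg r g i.*2.+1 - block_avg r g i.*2) ^+ 2 <=
  4 ^- r * \sum_(k < 2 ^ (n.+1 + r)) \sum_(l < 2 ^ (n.+1 + r))
     (split_at r k l)%:R * (g k - g l) ^+ 2.
Proof.
pose F k l : R := (split_at r k l)%:R * (g k - g l) ^+ 2.
have F0 k l : 0 <= F k l by rewrite mulr_ge0 ?ler0n ?sqr_ge0.
pose Y i j := \sum_(s < 2 ^ r) \sum_(t < 2 ^ r) F (i * 2 ^ r + s)%N (j * 2 ^ r + t)%N.
have Y0 i j : 0 <= Y i j by apply: sumr_ge0 => s _; apply: sumr_ge0.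
have -> : \sum_(k < 2 ^ (n.+1 + r)) \sum_(l < 2 ^ (n.+1 + r)) F k l =
   \sum_(i < 2 ^ n.+1) \sum_(j < 2 ^ n.+1) Y i j.
  rewrite expnD (sum_block _ _ _ (fun k => \sum_(l < 2 ^ n.+1 * 2 ^ r) F k l)).
  apply: eq_bigr => i _; rewrite exchange_big /=.
  rewrite (sum_block _ _ _ (fun l => \sum_(s < 2 ^ r) F (i * 2 ^ r + s)%N l)).
  by apply: eq_bigr => j _; rewrite exchange_big.
rewrite expnS mul2n (sum_double _ _ (fun i => \sum_(j < (2 ^ n).*2) Y i j)).
rewrite mulr_sumr; apply: ler_sum => i _.
rewrite -sqrrN opprB; apply: le_trans (sqr_avg_le _ _ _ _) _.
apply: ler_wpM2l; first by rewrite invr_ge0 exprn_ge0.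
have lti : (i.*2.+1 < (2 ^ n).*2)%N by have := ltn_ord i; lia.
rewrite ler_wpDr ?sumr_ge0// (bigD1 (Ordinal lti)) //= ler_wpDr ?sumr_ge0//.
rewrite /Y le_eqVlt; apply/orP; left; apply/eqP.
apply: eq_bigr => s _; apply: eq_bigr => t _; rewrite /F.
suff -> : split_at r (i.*2 * 2 ^ r + s) (i.*2.+1 * 2 ^ r + t) by rewrite mul1r.
rewrite /split_at !divnMDl ?expn_gt0// (divn_small (ltn_ord s)) (divn_small (ltn_ord t)) !addn0 !divn2 /=.
rewrite uphalf_double doubleK eqxx /=; lia.
Qed.

(** Leftmost ([false]) or rightmost ([true]) descendant after [d] halvings: the block that keeps the
    corresponding endpoint of block [i]. *)
Fixpoint desc (b : bool) d i : nat := if d is d'.+1 then desc b d' (i.*2 + b)%N else i.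

Lemma descF d i : desc false d i = (i * 2 ^ d)%N.
Proof. by elim: d i => [|d IH] i /=; rewrite ?muln1// IH expnS; lia. Qed.

Lemma descT d i : (desc true d i).+1 = (i.+1 * 2 ^ d)%N.
Proof. by elim: d i => [|d IH] i /=; rewrite ?muln1// IH expnS; lia. Qed.

(** The average of a block is that of its extreme child plus or minus half the sibling difference.
    Only one of the two children is followed, so the factor 3 / 2 of Young's inequality is
    affordable: (3 / 2) / (5 / 3) = 9 / 10, and (3 / 4) / (1 - 9 / 10) = 15 / 2. *)
Lemma sum_desc b n0 A :
  (forall n i, (n < n0)%N -> A n i = (A n.+1 i.*2 + A n.+1 i.*2.+1) / 2) ->
  \sum_(n < n0) (5 / 3) ^+ n * \sum_(i < 2 ^ n) (A n i - A n0 (desc b (n0 - n) i)) ^+ 2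
  <= 15 / 2 * \sum_(n < n0) (5 / 3) ^+ n *
       \sum_(i < 2 ^ n) (A n.+1 i.*2.+1 - A n.+1 i.*2) ^+ 2.
Proof.
move=> AS.
set T := fun n => (5 / 3) ^+ n * \sum_(i < 2 ^ n) (A n i - A n0 (desc b (n0 - n) i)) ^+ 2.
set a := fun n => (5 / 3) ^+ n * \sum_(i < 2 ^ n) (A n.+1 i.*2.+1 - A n.+1 i.*2) ^+ 2.
have : (1 - 9 / 10) * \sum_(n < n0) T n <= 3 / 4 * \sum_(n < n0) a n.
  apply: sum_contract; first by lra.
  - by rewrite /T subnn big1 ?mulr0// => i _ /=; rewrite subrr expr0n.
  - by move=> n; apply: mulr_ge0; [apply: exprn_ge0; lra
      | apply: sumr_ge0 => *; exact: sqr_ge0].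
  move=> n nn0; rewrite /T /a exprS.
  have -> x y : 9 / 10 * (5 / 3 * (5 / 3) ^+ n * x) + 3 / 4 * ((5 / 3) ^+ n * y)
     = (5 / 3 : R) ^+ n * (3 / 2 * x + 3 / 4 * y) by field.
  apply: ler_wpM2l; first by apply: exprn_ge0; lra.
  rewrite expnS mul2n (sum_double _ _ (fun i => (A n.+1 i - A n0 (desc b (n0 - n.+1) i)) ^+ 2)).
  rewrite !mulr_sumr -big_split /=; apply: ler_sum => i _.
  rewrite -subnSK//= AS//.
  set x := A n.+1 _; set y := A n.+1 _.
  have q1 := sqr_ge0 (x - A n0 (desc b (n0 - n.+1) i.*2)).
  have q2 := sqr_ge0 (y - A n0 (desc b (n0 - n.+1) i.*2.+1)).
  have key (t e : R) : (t + e) ^+ 2 <= 3 / 2 * t ^+ 2 + 3 * e ^+ 2.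
    have := sqr_ge0 (t - 2 * e); rewrite !expr2; nra.
  clear T a; case: b q1 q2 => /=.
  - rewrite addn1 -/y => q1 q2.
    have := key (y - A n0 (desc true (n0 - n.+1) i.*2.+1)) (- (y - x) / 2).
    rewrite (_ : _ + _ / 2 = (x + y) / 2 - A n0 (desc true (n0 - n.+1) i.*2.+1)); last by field.
    move=> /le_trans; apply.
    by rewrite exprMn sqrrN (_ : (2^-1) ^+ 2 = 1 / 4 :> R); [nra | field].
  - rewrite addn0 -/x => q1 q2.
    have := key (x - A n0 (desc false (n0 - n.+1) i.*2)) ((y - x) / 2).
    rewrite (_ : _ + _ / 2 = (x + y) / 2 - A n0 (desc false (n0 - n.+1) i.*2)); last by field.
    move=> /le_trans; apply.
    by rewrite exprMn (_ : (2^-1) ^+ 2 = 1 / 4 :> R); [nra | field].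
rewrite /T /a; lra.
Qed.

(** The level [n0] where averages are exchanged for point values is kept apart from the number [n1]
    of levels to be bounded: the error only carries a sum over [n1] levels, so [eps] can be fixed
    before [n0] is chosen. *)
Lemma discrete_lower n1 n0 r g (eps : R) : (n1 <= n0)%N -> 0 <= eps ->
  (forall i t, (i < 2 ^ n0)%N -> (t <= 2 ^ r)%N ->
     `|g (i * 2 ^ r + t)%N - g (i * 2 ^ r)%N| <= eps) ->
  \sum_(n < n1) (5 / 3) ^+ n *
    \sum_(i < 2 ^ n) (g (i.+1 * 2 ^ (n0 + r - n))%N - g (i * 2 ^ (n0 + r - n))%N) ^+ 2
  <= 60 * \sum_(n < n0) (5 / 3) ^+ n * (4 ^- (n0 + r - n.+1) *
       \sum_(k < 2 ^ (n0 + r)) \sum_(l < 2 ^ (n0 + r))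
         (split_at (n0 + r - n.+1) k l)%:R * (g k - g l) ^+ 2)
     + 20 * eps ^+ 2 * \sum_(n < n1) (10 / 3) ^+ n.
Proof.
move=> n10 eps0 osc.
pose A n i := block_avg (n0 + r - n) g i.
have AS n i : (n < n0)%N -> A n i = (A n.+1 i.*2 + A n.+1 i.*2.+1) / 2.
  by move=> nn0; rewrite /A -block_avgS; congr block_avg; lia.
have An0 i : A n0 i = block_avg r g i by rewrite /A addKn.
have avgl i : (i < 2 ^ n0)%N -> (A n0 i - g (i * 2 ^ r)%N) ^+ 2 <= eps ^+ 2.
  move=> lti; rewrite -real_normK ?num_real// ler_pXn2r ?nnegrE//.
  rewrite An0 /block_avg.
  have z2 : (2 : R) ^+ r != 0 by rewrite expf_neq0// pnatr_eq0.
  rewrite -[X in _ - X](mulKf z2).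
  have -> : 2 ^+ r * g (i * 2 ^ r)%N = \sum_(t < 2 ^ r) g (i * 2 ^ r)%N.
    by rewrite sumr_const card_ord -[RHS]mulr_natl natrX.
  rewrite -mulrBr -sumrB normrM ger0_norm ?invr_ge0 ?exprn_ge0//.
  rewrite ler_pdivrMl ?exprn_gt0//.
  apply: le_trans (ler_norm_sum _ _ _) _.
  apply: (@le_trans _ _ (\sum_(t < 2 ^ r) eps)).
    by apply: ler_sum => t _; apply: osc => //; exact: ltnW.
  by rewrite sumr_const card_ord -[X in X <= _]mulr_natl natrX.
have avgr i : (i < 2 ^ n0)%N -> (A n0 i - g (i.+1 * 2 ^ r)%N) ^+ 2 <= 4 * eps ^+ 2.
  move=> lti.
  have h1 := avgl i lti.
  have h2 : (g (i * 2 ^ r)%N - g (i.+1 * 2 ^ r)%N) ^+ 2 <= eps ^+ 2.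
    rewrite -real_normK ?num_real// ler_pXn2r ?nnegrE// distrC.
    by rewrite mulSn addnC; apply: osc.
  have := sqrD2_le _ (A n0 i - g (i * 2 ^ r)%N) (g (i * 2 ^ r)%N - g (i.+1 * 2 ^ r)%N).
  rewrite addrA subrK.
  by move: h1 h2; lra.
have hsum : \sum_(n < n0) (5 / 3) ^+ n *
       \sum_(i < 2 ^ n) (A n.+1 i.*2.+1 - A n.+1 i.*2) ^+ 2 <=
   \sum_(n < n0) (5 / 3) ^+ n * (4 ^- (n0 + r - n.+1) *
       \sum_(k < 2 ^ (n0 + r)) \sum_(l < 2 ^ (n0 + r))
         (split_at (n0 + r - n.+1) k l)%:R * (g k - g l) ^+ 2).
  apply: ler_sum => n _; apply: ler_wpM2l; first by apply: exprn_ge0; lra.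
  have := split_energy n (n0 + r - n.+1) g.
  by rewrite subnKC//; have := ltn_ord n; lia.
pose TT b n := (5 / 3) ^+ n * \sum_(i < 2 ^ n) (A n i - A n0 (desc b (n0 - n) i)) ^+ 2.
have trunc b : \sum_(n < n1) TT b n <= \sum_(n < n0) TT b n.
  rewrite -(subnKC n10) big_split_ord /= ler_wpDr// sumr_ge0// => n _.
  by apply: mulr_ge0; [apply: exprn_ge0; lra | apply: sumr_ge0 => *; exact: sqr_ge0].
have hTT b := le_trans (trunc b) (le_trans (sum_desc b n0 A AS)
  (ler_wpM2l (ltac:(lra) : 0 <= 15 / 2 :> R) hsum)).
suff main : \sum_(n < n1) (5 / 3) ^+ n *
    \sum_(i < 2 ^ n) (g (i.+1 * 2 ^ (n0 + r - n))%N - g (i * 2 ^ (n0 + r - n))%N) ^+ 2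
  <= \sum_(n < n1) (4 * TT true n + 4 * TT false n + 20 * eps ^+ 2 * (10 / 3) ^+ n).
  apply: le_trans main _; rewrite !big_split /= -!mulr_sumr.
  move: (hTT true) (hTT false).
  set X1 := \sum_(n < n1) TT true n; set X2 := \sum_(n < n1) TT false n.
  set Y := \sum_(n < n0) _; set Z := \sum_(n < n1) _; lra.
apply: ler_sum => n _; rewrite /TT.
have nn0 : (n < n0)%N by apply: leq_trans (ltn_ord n) n10.
have -> : (10 / 3 : R) ^+ n = (5 / 3) ^+ n * 2 ^+ n.
  by rewrite -exprMn; congr (_ ^+ _); field.
have -> x y : 4 * ((5 / 3) ^+ n * x) + 4 * ((5 / 3) ^+ n * y) +
  20 * eps ^+ 2 * ((5 / 3) ^+ n * 2 ^+ n) = (5 / 3) ^+ n * (4 * x + 4 * y + 20 * eps ^+ 2 * 2 ^+ n).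
  by ring.
apply: ler_wpM2l; first by apply: exprn_ge0; lra.
have -> : 20 * eps ^+ 2 * 2 ^+ n = \sum_(i < 2 ^ n) 20 * eps ^+ 2.
  by rewrite sumr_const card_ord -[RHS]mulr_natl natrX mulrC.
rewrite !mulr_sumr -!big_split /=; apply: ler_sum => i _.
have ed : (2 ^ (n0 + r - n) = 2 ^ (n0 - n) * 2 ^ r)%N by rewrite -expnD; congr expn; lia.
have e0 : (2 ^ n0 = 2 ^ n * 2 ^ (n0 - n))%N by rewrite -expnD subnKC// ltnW.
have dF : (desc false (n0 - n) i < 2 ^ n0)%N by rewrite descF e0 ltn_pmul2r ?expn_gt0.
have dT : (desc true (n0 - n) i < 2 ^ n0)%N by rewrite descT e0 leq_pmul2r ?expn_gt0.
have := avgl _ dF; have := avgr _ dT.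
rewrite descT descF -!mulnA -ed.
set gb := g _; set ga := g _; set a0 := A n i; set aT := A n0 _; set aF := A n0 _ => q1 q2.
(* The path between the endpoints of a block runs through the averages of its rightmost descendant,
   of the block itself and of its leftmost descendant. The two end pieces cost 4 * (4 + 1) = 20
   times [eps ^+ 2], the two middle ones 4 * 2 * 15 / 2 = 60. *)
have := sqrD4_le _ (gb - aT) (aT - a0) (a0 - aF) (aF - ga).
rewrite (_ : _ + _ + _ + _ = gb - ga); last by ring.
rewrite -(sqrrN (gb - aT)) opprB -(sqrrN (aT - a0)) opprB.
by move: q1 q2; lra.
Qed.

End discrete_lower.

(** * Integrals of dyadic step functions *)

Section integral_extra.
Context d (T : measurableType d) (R : realType) (mu : {measure set T -> \bar R}).

(** The integral of a nonnegative function is a supremum over simple functions below it, hence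
    monotone for arbitrary functions. The kernel and its inner integral can thus be compared with
    step functions directly. *)
Lemma ge0_le_integral_nomeas (D : set T) (f1 f2 : T -> \bar R) :
  (forall x, D x -> (0 <= f1 x)%E) -> (forall x, D x -> (f1 x <= f2 x)%E) ->
  (\int[mu]_(x in D) f1 x <= \int[mu]_(x in D) f2 x)%E.
Proof.
move=> f10 f12.
have f20 x : D x -> (0 <= f2 x)%E by move=> Dx; apply: le_trans (f12 _ Dx); exact: f10.
rewrite !(integral_mkcond D) !ge0_integralTE//; last 2 first.
- by move=> x; apply: erestrict_ge0.
- by move=> x; apply: erestrict_ge0.
apply: ereal_sup_le => _ [h /= hf1 <-]; exists h => //= x.
by apply: le_trans (hf1 x) _; apply: lee_restrict.
Qed.

Lemma limn_einf_ge (u : nat -> \bar R) (r : R) :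
  (forall e, 0 < e -> exists N, forall n, (N <= n)%N -> ((r - e)%:E <= u n)%E) ->
  (r%:E <= limn_einf u)%E.
Proof.
move=> h; rewrite limn_einf_lim (cvg_lim _ (@cvg_einfs_sup _ u))//.
apply/lee_addgt0Pr => e e0; have [N hN] := h e e0.
rewrite -leeBlDr// -EFinB; apply: (@le_trans _ _ (einfs u N)); last first.
  by apply: ereal_sup_ubound; exists N.
by apply: le_ereal_inf_tmp => _ [n /= Nn <-]; exact: hN.
Qed.

Lemma limn_einf_le_cst (u : nat -> \bar R) (B : \bar R) :
  (forall n, (u n <= B)%E) -> (limn_einf u <= B)%E.
Proof.
move=> h; rewrite limn_einf_lim (cvg_lim _ (@cvg_einfs_sup _ u))//.
apply: ge_ereal_sup => _ [n _ <-]; apply: le_trans (h n).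
by apply: ereal_inf_lbound; exists n => /=.
Qed.

Lemma integral_le_einf (D : set T) (f : nat -> T -> \bar R) (u : T -> \bar R) :
  measurable D -> (forall n, measurable_fun D (f n)) ->
  (forall n x, D x -> (0 <= f n x)%E) -> (forall x, D x -> (0 <= u x)%E) ->
  (forall x, D x -> (u x <= limn_einf (f^~ x))%E) ->
  (\int[mu]_(x in D) u x <= limn_einf (fun n => \int[mu]_(x in D) f n x))%E.
Proof.
move=> mD mf f0 u0 uf; apply: le_trans (fatou mu mD mf f0).
exact: ge0_le_integral_nomeas.
Qed.

End integral_extra.

(** Only [x] is confined to the segment; [y] may leave it, since compactness gives a uniform modulus
    on a neighbourhood. *)
Lemma segment_unif_continuous (R : realType) (g : R -> R) (a b e : R) :
  continuous g -> 0 < e -> exists2 dl, 0 < dl &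
    forall x y, x \in `[a, b]%classic -> `|x - y| < dl -> `|g x - g y| < e.
Proof.
move=> cg e0.
have /compact_near_coveringP/(_ R (0 : R)^'+
  (fun dl x => forall y, `|x - y| < dl -> `|g x - g y| < e) _) := @segment_compact R a b.
case=> [x _|dl /= dl0 H].
  have e20 : 0 < e / 2 by rewrite divr_gt0.
  have /cvgrPdist_lt/(_ _ e20)/nbhs_ballP[r /= r0 hr] := cg x.
  exists (ball x (r / 2), [set dl | dl < r / 2]) => /=; first split.
  - by apply: nbhsx_ballx; rewrite divr_gt0.
  - by apply: nbhs_right_lt; rewrite divr_gt0.
  move=> [z dl] /= [xz dlr] y zy.
  have hz := hr z; have hy := hr y.
  rewrite /ball /= in hz hy xz.
  have /hz hz' : `|x - z| < r by apply: lt_trans xz _; lra.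
  have /hy hy' : `|x - y| < r.
    rewrite (_ : x - y = (x - z) + (z - y)); last by ring.
    apply: le_lt_trans (ler_normD _ _) _; move: xz dlr zy; lra.
  rewrite (_ : g z - g y = (g x - g y) - (g x - g z)); last by ring.
  apply: le_lt_trans (ler_normB _ _) _; move: hz' hy'; lra.
exists (dl / 2); first by rewrite divr_gt0.
move=> x y; rewrite inE => xab xy; apply: (H (dl / 2)) => //=.
- by rewrite sub0r normrN gtr0_norm ?divr_gt0//; lra.
- by rewrite divr_gt0.
Qed.

Section grid.
Context {R : realType}.

Definition cell (M : nat) (x : R) : nat := Num.truncn (x * 2 ^+ M).

Definition gpt (M k : nat) : R := k%:R / 2 ^+ M.

Lemma gptS M k : gpt M k = gpt M.+1 k.*2.
Proof.
have z : (2 : R) ^+ M != 0 by rewrite expf_neq0.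
by rewrite /gpt exprS -muln2 natrM; field.
Qed.

Lemma gpt_succ M k : gpt M k.+1 = gpt M k + 2 ^- M.
Proof. by rewrite /gpt -natr1 mulrDl mul1r. Qed.

Lemma cellP M x k : 0 <= x -> (cell M x == k) = (gpt M k <= x < gpt M k.+1).
Proof.
move=> x0; have x1 : 0 <= x * 2 ^+ M by rewrite mulr_ge0 ?exprn_ge0.
rewrite /gpt ler_pdivrMr ?exprn_gt0// ltr_pdivlMr ?exprn_gt0//.
by rewrite eqn_leq /cell truncn_le_nat truncn_ge_nat// andbC.
Qed.

Lemma cell_bounds M x : 0 <= x -> gpt M (cell M x) <= x < gpt M (cell M x).+1.
Proof. by move=> x0; rewrite -cellP. Qed.

Lemma cell_div M r x : 0 <= x -> cell M x = (cell (M + r) x %/ 2 ^ r)%N.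
Proof.
move=> x0; apply/eqP; rewrite cellP//; have := cell_bounds (M + r) x x0.
set k := cell _ x; rewrite /gpt exprD => /andP[h1 h2].
have p2 : 0 < (2 : R) ^+ r by rewrite exprn_gt0.
have pM : 0 < (2 : R) ^+ M by rewrite exprn_gt0.
have e1 : (k %/ 2 ^ r * 2 ^ r <= k)%N by rewrite leq_divM.
have e2 : (k.+1 <= (k %/ 2 ^ r).+1 * 2 ^ r)%N by rewrite ltn_ceil// expn_gt0.
have q k' : k'%:R / (2 ^+ M * 2 ^+ r) = k'%:R / 2 ^+ r / 2 ^+ M :> R.
  by rewrite invfM; ring.
rewrite !q in h1 h2.
apply/andP; split.
  apply: le_trans h1; rewrite ler_pM2r ?invr_gt0// ler_pdivlMr//.
  by rewrite -natrX -natrM ler_nat.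
apply: lt_le_trans h2 _; rewrite ler_pM2r ?invr_gt0// ler_pdivrMr//.
by rewrite -natrX -natrM ler_nat.
Qed.

Variable m : nat.
Let D : set R := `[0, 2 ^- m].

Lemma cell_le N x : D x -> (cell (m + N) x <= 2 ^ N)%N.
Proof.
rewrite /D /= in_itv /= => /andP[x0 x1].
have /andP[+ _] := cell_bounds (m + N) x x0; rewrite /gpt ler_pdivrMr ?exprn_gt0//.
rewrite -(ler_nat R) => /le_trans; apply.
by rewrite exprD mulrA natrX ler_piMl ?exprn_ge0// -ler_pdivlMr ?exprn_gt0// mul1r.
Qed.

(** Cells are half-open and the segment is closed: its right endpoint alone falls into the cell of
    index [2 ^ N]. Hence the additional summand, which integrates to 0. *)
Let step N (h : nat -> R) (x : R) : R :=
  \sum_(k < (2 ^ N).+1) h k * \1_(`[gpt (m + N) k, gpt (m + N) k.+1[%classic) x.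

Let stepE N h x : D x -> h (cell (m + N) x) = step N h x.
Proof.
move=> Dx; have lt := cell_le N x Dx.
have x0 : 0 <= x by move: Dx; rewrite /D /= in_itv /= => /andP[].
rewrite /step (bigD1 (Ordinal (lt : (cell (m + N) x < (2 ^ N).+1)%N)))//= indicE.
rewrite mem_set ?mulr1; last by rewrite /= in_itv /= cell_bounds.
rewrite big1 ?addr0// => k /eqP kx; rewrite indicE memNset ?mulr0//=.
rewrite in_itv /= -cellP// => /eqP E; apply: kx; apply: val_inj => /=; by rewrite E.
Qed.

Let mstep N h (E : set R) : measurable_fun E (step N h).
Proof.
apply: measurable_sum => k; apply: measurable_funM => //; exact: measurable_indic.
Qed.

Lemma measurable_cell N (h : nat -> R) :
  measurable_fun D (fun x => (h (cell (m + N) x))%:E).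
Proof.
apply: (eq_measurable_fun (EFin \o step N h)).
  by move=> x; rewrite inE => Dx /=; rewrite -stepE.
by apply/measurable_EFinP; apply: mstep.
Qed.

Lemma integral_cell N (h : nat -> R) : (forall k, 0 <= h k) ->
  (\int[lebesgue_measure]_(x in D) (h (cell (m + N) x))%:E
   = (2 ^- (m + N) * \sum_(k < 2 ^ N) h k)%:E)%E.
Proof.
move=> h0; have mD : measurable D by exact: measurable_itv.
transitivity (\int[lebesgue_measure]_(x in D) (\sum_(k < (2 ^ N).+1)
   (h k * \1_(`[gpt (m + N) k, gpt (m + N) k.+1[%classic) x)%:E))%E.
  by apply: eq_integral => x; rewrite inE => Dx; rewrite stepE// /step sumEFin.
rewrite ge0_integral_sum//=; last 2 first.
- by move=> k; apply/measurable_EFinP; apply: measurable_funM => //; exact: measurable_indic.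
- by move=> k x _; rewrite lee_fin mulr_ge0.
have pM : 0 < (2 : R) ^+ (m + N) by rewrite exprn_gt0.
rewrite big_ord_recr /= mulr_sumr -sumEFin.
rewrite [X in (_ + X)%E = _](_ : _ = 0%E) ?adde0.
  apply: eq_bigr => k _.
  under eq_integral do rewrite EFinM.
  rewrite ge0_integralZl_EFin//; last exact/measurable_EFinP/measurable_indic.
  rewrite integral_indic// setIidl; last first.
    move=> x; rewrite /D /= !in_itv /= => /andP[x1 x2].
    rewrite (le_trans _ x1) ?divr_ge0 ?exprn_ge0//=.
    apply: (le_trans (ltW x2)); rewrite /gpt ler_pdivrMr// exprD mulKf ?expf_neq0//.
    by rewrite -natrX ler_nat.
  have e1 := lebesgue_measure_itv `[gpt (m + N) k, gpt (m + N) k.+1[.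
  rewrite /= lte_fin ltr_pM2r ?invr_gt0// ltr_nat ltnSn in e1.
  transitivity ((h k)%:E * lebesgue_measure (`[gpt (m + N) k, gpt (m + N) k.+1[%classic : set R))%E => //.
  by rewrite e1 -EFinB -EFinM -mulrBl -natrB// subSnn mul1r mulrC.
under eq_integral do rewrite EFinM.
rewrite ge0_integralZl_EFin//; last exact/measurable_EFinP/measurable_indic.
rewrite integral_indic//.
have -> : `[gpt (m + N) (2 ^ N), gpt (m + N) (2 ^ N).+1[%classic `&` D = [set (2 ^- m : R)].
  have e : gpt (m + N) (2 ^ N) = 2 ^- m.
    by rewrite /gpt exprD natrX invfM mulrCA mulfV ?mulr1// expf_neq0.
  rewrite eqEsubset; split => x /=.
    rewrite /D /= !in_itv /= e => -[/andP[h1 _] /andP[_ h2]].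
    by apply/eqP; rewrite eq_le h1 h2.
  move=> ->; rewrite /D /= !in_itv /= e lexx invr_ge0 exprn_ge0//= -e; split => //.
  by rewrite /gpt ltr_pM2r ?invr_gt0// ltr_nat.
transitivity ((h (2 ^ N)%N)%:E * lebesgue_measure [set (2 ^- m : R)])%E => //.
by rewrite lebesgue_measure_set1 mule0.
Qed.

Lemma integral_cell2 N (H : nat -> nat -> R) : (forall k l, 0 <= H k l) ->
  (\int[lebesgue_measure]_(x in D) \int[lebesgue_measure]_(y in D)
      (H (cell (m + N) x) (cell (m + N) y))%:E
   = (4 ^- (m + N) * \sum_(k < 2 ^ N) \sum_(l < 2 ^ N) H k l)%:E)%E.
Proof.
move=> H0.
under eq_integral => x _ do rewrite (integral_cell N (H (cell (m + N) x)))//.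
rewrite (integral_cell N (fun k => 2 ^- (m + N) * \sum_(l < 2 ^ N) H k l)).
  rewrite -mulr_sumr mulrA -invfM -exprMn.
  by congr (_ * _)%:E; congr (_ ^- _); ring.
by move=> k; rewrite mulr_ge0 ?invr_ge0 ?exprn_ge0// sumr_ge0.
Qed.

End grid.

(** * The exponent of the kernel *)

Section power.
Variable R : realType.
Local Notation p := (1 + 2 * beta R).

Lemma power_ge0 : 0 <= p.
Proof.
rewrite /beta; have : 0 <= ln (5 / 3 : R) / ln 4.
  by rewrite divr_ge0// ln_ge0//; lra.
lra.
Qed.

(** As ln 4 = 2 ln 2, the exponent is 2 + log2 (5 / 3), and 4 * 5 / 3 = 20 / 3. *)
Lemma two_power : 2 `^ p = 20 / 3 :> R.
Proof.
rewrite /powR pnatr_eq0 /=.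
have l2 : 0 < ln (2 : R) by apply: ln_gt0; lra.
have l4 : ln (4 : R) = ln 2 + ln 2.
  by rewrite -lnM ?posrE// -natrM.
have -> : p * ln 2 = ln 2 + ln 2 + ln (5 / 3 : R).
  by rewrite /beta l4; field; rewrite gt_eqF//; lra.
rewrite !expRD !lnK ?posrE//; lra.
Qed.

Lemma dyadic_power M : (2 ^- M) `^ p = (20 / 3) ^- M :> R.
Proof.
have h : (2^-1) `^ p = (20 / 3)^-1 :> R.
  by rewrite -powR_inv1// powRAC two_power powR_inv1//; lra.
rewrite -exprVn -powR_mulrn ?invr_ge0// powRAC h powR_mulrn ?invr_ge0 ?exprVn//; lra.
Qed.

End power.

(** * The Gagliardo seminorm on a segment *)

Lemma dyadic_small (R : realType) (e : R) : 0 < e -> exists j, forall n, (j <= n)%N -> 2 ^- n < e.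
Proof.
move=> e0; exists (Num.truncn e^-1).+1 => n hn.
rewrite -[e]invrK ltf_pV2 ?posrE ?invr_gt0 ?exprn_gt0//.
apply: lt_le_trans (truncnS_gt _) _; rewrite -natrX ler_nat.
by apply: leq_trans hn _; apply: ltnW; exact: ltn_expl.
Qed.

Lemma small_square (R : realType) (A eta : R) : 0 <= A -> 0 < eta ->
  exists2 e : R, 0 < e & A * e ^+ 2 <= eta.
Proof.
move=> A0 eta0; exists (Num.min 1 (eta / (A + 1))).
  by rewrite lt_min ltr01 divr_gt0//; lra.
set e := Num.min _ _.
have e0 : 0 < e by rewrite lt_min ltr01 divr_gt0//; lra.
have e1 : e <= 1 by rewrite ge_min lexx.
have : e <= eta / (A + 1) by rewrite ge_min lexx orbT.
rewrite ler_pdivlMr; last lra.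
have : e ^+ 2 <= e by rewrite expr2 ler_piMl// ltW.
move=> /(ler_wpM2l A0); nra.
Qed.

Section gagliardo.
Variable R : realType.
Local Notation p := (1 + 2 * beta R).
Variables (m : nat) (g : R -> R).
Let D : set R := `[0, 2 ^- m].
Let K (x y : R) : R := (g x - g y) ^+ 2 / (`|x - y| `^ p).

Definition gagliardo : \bar R :=
  (\int[lebesgue_measure]_(x in D) \int[lebesgue_measure]_(y in D) (K x y)%:E)%E.

Hypothesis cg : continuous g.

Let G n k := g (gpt (m + n) k).

Let GS n k : G n k = G n.+1 k.*2.
Proof. by rewrite /G gptS addnS. Qed.

Let G_refine n s j : G n j = G (n + s) (j * 2 ^ s).
Proof.
elim: s n j => [|s IH] n j; first by rewrite addn0 muln1.
by rewrite GS IH addSnnS expnS -muln2 -mulnA.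
Qed.

Let K0 x y : 0 <= K x y.
Proof. by rewrite divr_ge0 ?sqr_ge0 ?powR_ge0. Qed.

Let Dge0 x : D x -> 0 <= x.
Proof. by rewrite /D /= in_itv /= => /andP[]. Qed.

Let gpt_cell M (x : R) : 0 <= x -> `|x - gpt M (cell M x)| <= 2 ^- M.
Proof.
move=> x0; have /andP[h1 h2] := cell_bounds M x x0.
rewrite ger0_norm ?subr_ge0//.
by move: h2; rewrite gpt_succ; lra.
Qed.

Let cvg_G x : D x -> G N (cell (m + N) x) @[N --> \oo] --> g x.
Proof.
move=> Dx; apply: (cvg_comp (fun N => gpt (m + N) (cell (m + N) x)) g _ (cg x)).
apply/cvgrPdist_lt => e e0; have [j hj] := dyadic_small _ _ e0.
exists j => // N /= jN; apply: le_lt_trans (gpt_cell _ _ (Dge0 _ Dx)) _.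
by apply: hj; rewrite (leq_trans jN)// leq_addl.
Qed.

Let cell_neighbors M (x y : R) : 0 <= x -> 0 <= y -> `|x - y| <= 2 ^- M ->
  neighbors (cell M x) (cell M y).
Proof.
move=> x0 y0; rewrite ler_norml => /andP[h1 h2].
have /andP[a1 a2] := cell_bounds M x x0; have /andP[b1 b2] := cell_bounds M y y0.
have pM : 0 < (2 : R) ^- M by rewrite invr_gt0 exprn_gt0.
rewrite !gpt_succ /gpt in a1 a2 b1 b2.
have q (k l : nat) : k%:R / 2 ^+ M < l%:R / 2 ^+ M + 2 ^- M + 2 ^- M :> R -> (k <= l.+1)%N.
  by rewrite -{3 4}[2 ^- M]mul1r -!mulrDl ltr_pM2r// !natr1 ltr_nat ltnS.
by rewrite /neighbors; apply/andP; split; apply: q; lra.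
Qed.

(** Step majorant of the kernel. All scales are summed because the cells of [x] and [y] do not
    determine the scale of [|x - y|]; only the summand of that scale is used. The exponent [m.+1]
    allows for the smallest distance there, which is just above [2 ^- (m + n).+1]. *)
Let H N k l : R := (20 / 3) ^+ m.+1 * (\sum_(n < N.+1)
  (neighbors (k %/ 2 ^ (N - n)) (l %/ 2 ^ (N - n)))%:R * (20 / 3) ^+ n
    * (G N k - G N l) ^+ 2).

Let term0 (b : bool) n a : 0 <= b%:R * (20 / 3) ^+ n * a ^+ 2 :> R.
Proof.
by apply: mulr_ge0; [apply: mulr_ge0; [|apply: exprn_ge0; lra] | exact: sqr_ge0].
Qed.

Let H0 N k l : 0 <= H N k l.
Proof.
apply: mulr_ge0; first by apply: exprn_ge0; lra.
by apply: sumr_ge0 => n _; exact: term0.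
Qed.

Let dyadic_scale x y : D x -> D y -> x != y ->
  exists2 n, `|x - y| <= 2 ^- (m + n) & 2 ^- (m + n).+1 < `|x - y|.
Proof.
rewrite /D /= !in_itv /= => /andP[x0 x1] /andP[y0 y1] xy.
have d0 : 0 < `|x - y| by rewrite normr_gt0 subr_eq0.
have [j hj] := dyadic_small _ _ d0.
have ex : exists n, 2 ^- (m + n).+1 < `|x - y|.
  by exists j; apply: hj; rewrite -addnS; lia.
case: (ex_minnP ex) => n hn hmin; exists n => //.
case: n hn hmin => [|n] hn hmin.
  rewrite addn0 ler_norml; apply/andP; split; lra.
rewrite leNgt; apply/negP; rewrite addnS => /hmin; by rewrite ltnn.
Qed.

Let K_le_einf x y : D x -> D y ->
  ((K x y)%:E <= limn_einf (fun N => (H N (cell (m + N) x) (cell (m + N) y))%:E))%E.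
Proof.
move=> Dx Dy; apply: limn_einf_ge => e e0.
have [<-|xy] := eqVneq x y.
  exists 0 => n _; rewrite lee_fin /K subrr expr0n mul0r.
  by apply: le_trans (H0 _ _ _); lra.
have [n hn1 hn2] := dyadic_scale _ _ Dx Dy xy.
set c : R := (20 / 3) ^+ (m + n).+1.
have c0 : 0 <= c by apply: exprn_ge0; lra.
have : c * (G N (cell (m + N) x) - G N (cell (m + N) y)) ^+ 2 @[N --> \oo]
   --> c * (g x - g y) ^+ 2.
  under eq_fun do rewrite expr2.
  have h : G N (cell (m + N) x) - G N (cell (m + N) y) @[N --> \oo] --> g x - g y.
    by apply: cvgB; exact: cvg_G.
  by rewrite expr2; apply: cvgM; [exact: cvg_cst | exact: cvgM].
move=> /cvgrPdist_le/(_ _ e0)[N1 _ hN1]; exists (maxn N1 n) => N.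
rewrite geq_max => /andP[NN1 Nn]; rewrite lee_fin.
have := hN1 N NN1; rewrite ler_norml => /andP[_ hN].
have Kc : K x y <= c * (g x - g y) ^+ 2.
  rewrite /K mulrC ler_wpM2r ?sqr_ge0//.
  have -> : c = ((2 ^- (m + n).+1) `^ p)^-1 by rewrite dyadic_power invrK.
  rewrite lef_pV2 ?posrE ?powR_gt0 ?normr_gt0 ?subr_eq0 ?invr_gt0 ?exprn_gt0//.
  by rewrite ge0_ler_powR ?power_ge0 ?nnegrE ?invr_ge0 ?exprn_ge0// ltW.
suff : c * (G N (cell (m + N) x) - G N (cell (m + N) y)) ^+ 2 <=
    H N (cell (m + N) x) (cell (m + N) y) by move: hN Kc; lra.
rewrite /H /c -addSn exprD -mulrA; apply: ler_wpM2l; first by apply: exprn_ge0; lra.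
rewrite (bigD1 (Ordinal (Nn : (n < N.+1)%N)))//=.
have e1 z : D z -> (cell (m + N) z %/ 2 ^ (N - n))%N = cell (m + n) z.
  move=> Dz; rewrite (cell_div (m + n) (N - n)) ?Dge0//.
  by rewrite -addnA subnKC.
rewrite !e1// cell_neighbors ?Dge0// mul1r ler_wpDr// sumr_ge0// => k _; exact: term0.
Qed.

(** Fatou's lemma is applied twice, in [y] for fixed [x] and then in [x] to the step functions
    [f N]. For each [N] the resulting integral is a finite sum to which [discrete_upper] applies. *)
Lemma gagliardo_upper (S : R) :
  (forall N, \sum_(n < N) (5 / 3) ^+ n * \sum_(k < 2 ^ n)
     (g (gpt (m + n) k.+1) - g (gpt (m + n) k)) ^+ 2 <= S) ->
  (gagliardo <= (4 ^- m * (20 / 3) ^+ m.+1 * 33 * S)%:E)%E.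
Proof.
move=> hS; have mD : measurable D by exact: measurable_itv.
pose f N (x : R) := (2 ^- (m + N) * \sum_(l < 2 ^ N) H N (cell (m + N) x) l)%:E.
have inner (x : R) : D x -> (\int[lebesgue_measure]_(y in D) (K x y)%:E <= limn_einf (f^~ x))%E.
  move=> Dx; have := @integral_le_einf _ _ _ (@lebesgue_measure R) D
    (fun N y => (H N (cell (m + N) x) (cell (m + N) y))%:E) (fun y => (K x y)%:E) mD.
  rewrite (_ : (fun n : nat => _) = f^~ x).
    move=> h; apply: h => //.
    - by move=> N; exact: (measurable_cell m N (H N (cell (m + N) x))).
    - by move=> N y _; rewrite lee_fin.
    - by move=> y _; rewrite lee_fin.
    - by move=> y Dy; exact: K_le_einf.
  apply/funext => N; exact: (integral_cell m N (H N (cell (m + N) x))).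
apply: (@le_trans _ _ (limn_einf (fun N => \int[lebesgue_measure]_(x in D) f N x))%E).
  apply: integral_le_einf => //.
  - by move=> N; apply: (measurable_cell m N (fun k => 2 ^- (m + N) * \sum_(l < 2 ^ N) H N k l)).
  - move=> N x _; rewrite /f lee_fin mulr_ge0 ?invr_ge0 ?exprn_ge0// sumr_ge0//.
  - by move=> x _; apply: integral_ge0 => y _; rewrite lee_fin.
apply: limn_einf_le_cst => N.
rewrite /f (integral_cell m N (fun k => 2 ^- (m + N) * \sum_(l < 2 ^ N) H N k l)); last first.
  by move=> k; rewrite mulr_ge0 ?invr_ge0 ?exprn_ge0// sumr_ge0.
rewrite lee_fin -mulr_sumr /H.
under eq_bigr do rewrite -mulr_sumr.
rewrite -mulr_sumr.
have := discrete_upper R G GS N => h.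
have {}h := le_trans h (ler_wpM2l (ltac:(lra) : 0 <= 33 :> R) (hS N.+1)).
have c0 : 0 <= 4 ^- m * (20 / 3) ^+ m.+1 :> R.
  by rewrite mulr_ge0 ?invr_ge0 ?exprn_ge0//; lra.
have := ler_wpM2l c0 h.
set X := \sum_(k < _) _; rewrite -!mulrA => /(le_trans _); apply.
rewrite le_eqVlt; apply/orP; left; apply/eqP.
have e4 : (4 : R) = 2 * 2 by rewrite -natrM.
have z1 : (2 : R) ^+ m != 0 by rewrite expf_neq0.
have z2 : (2 : R) ^+ N != 0 by rewrite expf_neq0.
by rewrite e4 !exprMn !exprD; field; rewrite z1 z2.
Qed.

Let osc_grid (dl e : R) n0 r : 
  (forall x y, x \in D -> `|x - y| < dl -> `|g x - g y| < e) ->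
  2 ^- (m + n0) < dl -> forall i t, (i < 2 ^ n0)%N -> (t <= 2 ^ r)%N ->
  `|G (n0 + r) (i * 2 ^ r + t) - G (n0 + r) (i * 2 ^ r)| <= e.
Proof.
move=> h hdl i t lti let_; rewrite distrC; apply/ltW/h.
  rewrite inE /D /= in_itv /= /gpt divr_ge0 ?exprn_ge0//=.
  rewrite ler_pdivrMr ?exprn_gt0// exprD mulKf ?expf_neq0// -natrX ler_nat expnD.
  by rewrite leq_pmul2r ?expn_gt0// ltnW.
apply: le_lt_trans hdl; rewrite /gpt -mulrBl natrD opprD addNKr normrM normrN.
rewrite !ger0_norm ?invr_ge0 ?exprn_ge0//.
rewrite addnA exprD invfM mulrCA ler_piMr ?invr_ge0 ?exprn_ge0//.
by rewrite ler_pdivrMr ?exprn_gt0// mul1r -natrX ler_nat.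
Qed.

Lemma gagliardo_lower (B : R) : (gagliardo <= B%:E)%E ->
  forall n1, \sum_(n < n1) (5 / 3) ^+ n * \sum_(k < 2 ^ n)
     (g (gpt (m + n) k.+1) - g (gpt (m + n) k)) ^+ 2 <= 480 * (3 / 5) ^+ m * B.
Proof.
move=> hB n1; apply/ler_addgt0Pr => eta eta0.
have eta20 : 0 < eta / 2 by lra.
(* Order of the choices: [e0] depends on [n1] alone, [n0] makes the oscillation on cells of level
   [m + n0] at most [e0], [e1] may depend on [n0] through [E], and [r] makes the sampling error at
   level [m + N] at most [e1]. *)
have [|e0 e0p he0] := small_square R (20 * \sum_(n < n1) (10 / 3) ^+ n) _ _ eta20.
  by rewrite mulr_ge0// sumr_ge0// => n _; apply: exprn_ge0; lra.
have [dl0 dl0p hdl0] := segment_unif_continuous R g 0 (2 ^- m) e0 cg e0p.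
have [j0 hj0] := dyadic_small _ _ dl0p.
pose n0 := maxn n1 j0.
have n10 : (n1 <= n0)%N by exact: leq_maxl.
have n0dl : 2 ^- (m + n0) < dl0.
  by apply: hj0; rewrite (leq_trans (leq_maxr n1 j0))// leq_addl.
have [c [cE c0]] : exists c : R, c = 480 * (3 / 5) ^+ m /\ 0 <= c.
  by eexists; split; [reflexivity|]; apply: mulr_ge0; [exact: ler0n | apply: exprn_ge0; lra].
pose E := \sum_(n < n0) (20 / 3 : R) ^+ (m + n).
have E0 : 0 <= E by apply: sumr_ge0 => n _; apply: exprn_ge0; lra.
have [|e1 e1p he1] := small_square R (c * (4 ^- m * (4 * E))) _ _ eta20.
  apply: mulr_ge0 => //; apply: mulr_ge0; first by rewrite invr_ge0 exprn_ge0.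
  by apply: mulr_ge0.
have [dl1 dl1p hdl1] := segment_unif_continuous R g 0 (2 ^- m) e1 cg e1p.
have [r hr] := dyadic_small _ _ dl1p.
pose N := (n0 + r)%N.
have Ndl : 2 ^- (m + N) < dl1 by apply: hr; rewrite /N addnA leq_addl.
have n0N n : (n < n0)%N -> (n < N)%N by move=> h; rewrite (leq_trans h)// leq_addr.
pose gm k := G N k.
pose spl n k l : R := (split_at (N - n.+1) k l)%:R.
(* Step minorant of the kernel: half the square minus [4 * e1 ^+ 2] pays for replacing [g] by grid
   values. As a pair is split at no more than one scale, at most one summand is nonzero. *)
pose w k l : R := \sum_(n < n0) (20 / 3) ^+ (m + n) * (spl n k l * ((gm k - gm l) ^+ 2 / 2 - 4 * e1 ^+ 2)).
pose M n := \sum_(k < 2 ^ N) \sum_(l < 2 ^ N) spl n k l * (gm k - gm l) ^+ 2.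
have low : \sum_(n < n1) (5 / 3) ^+ n * \sum_(k < 2 ^ n) (g (gpt (m + n) k.+1) - g (gpt (m + n) k)) ^+ 2
    <= 60 * \sum_(n < n0) (5 / 3) ^+ n * (4 ^- (N - n.+1) * M n) + eta / 2.
  have := discrete_lower R n1 n0 r gm e0 n10 (ltW e0p) (osc_grid _ _ _ _ hdl0 n0dl).
  move=> /le_trans h; apply: le_trans (h _ _) => {h}; last first.
    by rewrite lerD2l; move: he0; lra.
  rewrite le_eqVlt; apply/orP; left; apply/eqP.
  apply: eq_bigr => n _; congr (_ * _); apply: eq_bigr => k _.
  have GN j : G n j = gm (j * 2 ^ (n0 + r - n))%N.
    by rewrite (G_refine n (N - n)) /gm subnKC// ltnW// n0N// (leq_trans (ltn_ord n)).
  by rewrite -!GN.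
have wK : forall x y, D x -> D y -> Num.max 0 (w (cell (m + N) x) (cell (m + N) y)) <= K x y.
  move=> x y Dx Dy; rewrite ge_max K0 /=.
  have cl z n : (n <= N)%N -> D z -> (cell (m + N) z %/ 2 ^ (N - n))%N = cell (m + n) z.
    move=> nN Dz; rewrite (cell_div (m + n) (N - n)) ?Dge0//.
    by rewrite -addnA subnKC.
  have splE (n : nat) : (n < n0)%N -> split_at (N - n.+1) (cell (m + N) x) (cell (m + N) y)
      = (cell (m + n) x == cell (m + n) y) && (cell (m + n.+1) x != cell (m + n.+1) y).
    move=> nn0; have nN := n0N n nn0.
    rewrite /split_at -!divnMA -expnSr subnSK// !cl// ltnW//.
  have [[n splitn]|nosplit] := pselect (exists n : 'I_n0,
      split_at (N - n.+1) (cell (m + N) x) (cell (m + N) y)); last first.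
    rewrite /w big1// => n _; rewrite /spl; case: (boolP (split_at _ _ _)) => [s|_].
      by exfalso; apply: nosplit; exists n.
    by rewrite mul0r mulr0.
  rewrite /w (bigD1 n)//= big1 ?addr0; last first.
    move=> n' n'n; rewrite /spl (_ : split_at _ _ _ = false) ?mul0r ?mulr0//.
    apply/negP => sn'; move: splitn sn'; rewrite !splE//.
    have coarse (a b : nat) : (a <= b)%N -> cell (m + b) x == cell (m + b) y ->
        cell (m + a) x == cell (m + a) y.
      move=> ab /eqP h; rewrite !(cell_div (m + a) (b - a)) ?Dge0//.
      by rewrite -!addnA subnKC// h.
    move=> /andP[p1 p2] /andP[p3 p4].
    case: (ltngtP n n') => nn'.
    - by move/negP: p2; apply; apply: coarse p3.
    - by move/negP: p4; apply; apply: coarse p1.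
    - by move/eqP: n'n; apply; apply: val_inj.
  rewrite /spl splitn mul1r.
  move: splitn; rewrite splE// => /andP[/eqP s1 s2].
  have xy : x != y by apply: contra s2 => /eqP ->.
  have dxy : `|x - y| <= 2 ^- (m + n).
    have /andP[a1 a2] := cell_bounds (m + n) x (Dge0 _ Dx).
    have /andP[b1 b2] := cell_bounds (m + n) y (Dge0 _ Dy).
    rewrite s1 in a1 a2; rewrite !gpt_succ in a2 b2.
    by rewrite ler_norml; apply/andP; split; lra.
  apply: (@le_trans _ _ ((20 / 3) ^+ (m + n) * (g x - g y) ^+ 2)).
    apply: ler_wpM2l; first by apply: exprn_ge0; lra.
    have near z : D z -> `|g z - gm (cell (m + N) z)| <= e1.
      move=> Dz; apply/ltW/hdl1; first by rewrite inE.
      by apply: le_lt_trans Ndl; apply: gpt_cell; exact: Dge0.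
    move: (near x Dx) (near y Dy).
    set a := gm _; set b := gm _; rewrite !ler_norml => /andP[u1 u2] /andP[v1 v2].
    have q : ((a - b) - (g x - g y)) ^+ 2 <= 4 * e1 ^+ 2.
      rewrite (_ : 4 * e1 ^+ 2 = (2 * e1) ^+ 2); last by ring.
      rewrite -real_normK ?num_real// ler_pXn2r ?nnegrE//; last by lra.
      by rewrite ler_norml; apply/andP; split; lra.
    have := sqrD2_le _ ((a - b) - (g x - g y)) (g x - g y); rewrite subrK.
    by move: q; lra.
  rewrite /K [leRHS]mulrC ler_wpM2r ?sqr_ge0//.
  have -> : (20 / 3 : R) ^+ (m + n) = ((2 ^- (m + n)) `^ p)^-1 by rewrite dyadic_power invrK.
  rewrite lef_pV2 ?posrE ?powR_gt0 ?normr_gt0 ?subr_eq0 ?invr_gt0 ?exprn_gt0//.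
  by rewrite ge0_ler_powR ?power_ge0 ?nnegrE ?invr_ge0 ?exprn_ge0.
have Bw : 4 ^- (m + N) * \sum_(k < 2 ^ N) \sum_(l < 2 ^ N) w k l <= B.
  rewrite -lee_fin; apply: le_trans hB.
  apply: (@le_trans _ _ (\int[lebesgue_measure]_(x in D) \int[lebesgue_measure]_(y in D)
      ((fun k l => Num.max 0 (w k l)) (cell (m + N) x) (cell (m + N) y))%:E)%E).
    rewrite (integral_cell2 m N (fun k l => Num.max 0 (w k l))); last first.
      by move=> k l; rewrite le_max lexx.
    rewrite lee_fin ler_wpM2l ?invr_ge0 ?exprn_ge0//.
    by apply: ler_sum => k _; apply: ler_sum => l _; rewrite le_max lexx orbT.
  apply: ge0_le_integral_nomeas => [x Dx|x Dx].
    by apply: integral_ge0 => y Dy; rewrite lee_fin le_max lexx.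
  apply: ge0_le_integral_nomeas => [y Dy|y Dy]; first by rewrite lee_fin le_max lexx.
  by rewrite lee_fin; exact: wK.
have sumw : \sum_(k < 2 ^ N) \sum_(l < 2 ^ N) w k l >=
    2^-1 * \sum_(n < n0) (20 / 3) ^+ (m + n) * M n - 4 ^+ N * (4 * e1 ^+ 2 * E).
  have -> : 4 ^+ N * (4 * e1 ^+ 2 * E) = \sum_(k < 2 ^ N) \sum_(l < 2 ^ N) (4 * e1 ^+ 2 * E).
    rewrite !sumr_const card_ord -mulrnA -[RHS]mulr_natl natrM natrX -exprMn -natrM.
    by [].
  have -> : \sum_(n < n0) (20 / 3) ^+ (m + n) * M n =
     \sum_(k < 2 ^ N) \sum_(l < 2 ^ N) \sum_(n < n0) (20 / 3) ^+ (m + n) * (spl n k l * (gm k - gm l) ^+ 2).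
    under [RHS]eq_bigr do rewrite exchange_big.
    rewrite [RHS]exchange_big; apply: eq_bigr => n _.
    by rewrite mulr_sumr; apply: eq_bigr => k _; rewrite mulr_sumr.
  rewrite mulr_sumr -sumrB; apply: ler_sum => k _.
  rewrite mulr_sumr -sumrB; apply: ler_sum => l _.
  rewrite /w /E mulr_sumr mulr_sumr -sumrB; apply: ler_sum => n _.
  have p0 : 0 <= (20 / 3 : R) ^+ (m + n) by apply: exprn_ge0; lra.
  have e20 := sqr_ge0 e1; have g0 := sqr_ge0 (gm k - gm l).
  rewrite [X in _ - X]mulrC mulrCA -mulrBr; apply: ler_wpM2l => //.
  by rewrite /spl; case: split_at; rewrite ?mul1r ?mul0r; lra.
(* The 8 is 2 from the halved square times 4 from [4 ^- N] against [4 ^- (N - n.+1)]; together with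
   60 it makes 480. *)
have conv : 4 ^- (m + N) * (2^-1 * \sum_(n < n0) (20 / 3) ^+ (m + n) * M n)
   = (5 / 3) ^+ m / 8 * \sum_(n < n0) (5 / 3) ^+ n * (4 ^- (N - n.+1) * M n).
  rewrite mulrA !mulr_sumr; apply: eq_bigr => n _.
  have nN := n0N n (ltn_ord n).
  have e1' j : (20 / 3 : R) ^+ j = (5 / 3) ^+ j * 4 ^+ j.
    by rewrite -exprMn; congr (_ ^+ _); field.
  have eN : (4 : R) ^+ N = 4 ^+ n * 4 * 4 ^+ (N - n.+1) by rewrite -exprSr -exprD subnKC.
  rewrite e1' !(exprD _ m) eN.
  have z1 : (4 : R) ^+ m != 0 by rewrite expf_neq0.
  have z2 : (4 : R) ^+ n != 0 by rewrite expf_neq0.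
  have z3 : (4 : R) ^+ (N - n.+1) != 0 by rewrite expf_neq0.
  by field; rewrite z1 z2 z3.
have p4 : 0 <= 4 ^- (m + N) :> R by rewrite invr_ge0 exprn_ge0.
have := ler_wpM2l p4 sumw; rewrite mulrBr conv => h1.
have h2 : 4 ^- (m + N) * (4 ^+ N * (4 * e1 ^+ 2 * E)) = 4 ^- m * (4 * E) * e1 ^+ 2.
  have z1 : (4 : R) ^+ m != 0 by rewrite expf_neq0.
  have z2 : (4 : R) ^+ N != 0 by rewrite expf_neq0.
  by rewrite (exprD _ m); field; rewrite z1 z2.
rewrite h2 in h1.
set Y := \sum_(n < n0) _ in low h1 conv.
have h3 := le_trans h1 Bw.
have h4 : Y <= 8 * (3 / 5) ^+ m * (B + 4 ^- m * (4 * E) * e1 ^+ 2).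
  have inv : (3 / 5 : R) ^+ m * (5 / 3) ^+ m = 1.
    by rewrite -exprMn (_ : 3 / 5 * (5 / 3) = 1) ?expr1n//; field.
  have p0 : 0 <= 8 * (3 / 5 : R) ^+ m by rewrite mulr_ge0// exprn_ge0//; lra.
  have h5 : (5 / 3) ^+ m / 8 * Y <= B + 4 ^- m * (4 * E) * e1 ^+ 2 by move: h3; lra.
  have := ler_wpM2l p0 h5.
  rewrite (_ : 8 * (3 / 5) ^+ m * ((5 / 3) ^+ m / 8 * Y) = ((3 / 5) ^+ m * (5 / 3) ^+ m) * Y); last by field.
  by rewrite inv mul1r.
apply: le_trans low _; rewrite -cE.
have : 60 * Y <= c * B + c * (4 ^- m * (4 * E)) * e1 ^+ 2.
  rewrite cE; move: h4; lra.
move: he1; lra.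
Qed.

End gagliardo.

(** * Subdivision of one triangle *)

(** Young's inequality with a leading factor so close to 1 that the contractions below survive
    it. *)
Lemma sqrD_le11 (R : realFieldType) (x y : R) :
  (x + y) ^+ 2 <= 11 / 10 * x ^+ 2 + 11 * y ^+ 2.
Proof.
have := sqr_ge0 (x - 10 * y); rewrite !expr2; nra.
Qed.

(** Naming the third corner and expanding sums over corners lets the later identities treat [i] and
    [j] symbolically, without enumerating cases. *)
Lemma ord3_third (R : realFieldType) (i j : 'I_3) : i != j -> exists k, [/\ k != i, k != j &
  forall F : 'I_3 -> R, \sum_l F l = F i + F j + F k].
Proof.
move=> ij; have [k /andP[ki kj]] : exists k, (k != i) && (k != j).
  case: i j ij => [[|[|[|]]]//= ?] [[|[|[|]]]//= ?] // _;
    by [exists (@Ordinal 3 0 isT)|exists (@Ordinal 3 1 isT)|exists (@Ordinal 3 2 isT)].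
exists k; split=> // F.
rewrite (bigD1 i)//= (bigD1 j)/= 1?eq_sym// (bigD1 k)/= ?ki ?kj// big1 ?addr0 ?addrA//.
move=> l /andP[/andP[li lj] lk]; exfalso; move: ij ki kj li lj lk.
case: i => [[|[|[|]]]//= ?]; case: j => [[|[|[|]]]//= ?];
  case: k => [[|[|[|]]]//= ?]; by case: l => [[|[|[|]]]//= ?].
Qed.

Section triangle.
Variable R : realFieldType.
Implicit Types (a : 'I_3 -> R) (M : 'I_3 -> 'I_3 -> R) (i j : 'I_3).

Definition tri_energy a : R := \sum_i \sum_(j | i != j) (a i - a j) ^+ 2.

(* With k the third corner, this is the rule [(2 a i + 2 a j + a k) / 5]. *)
Definition harm a i j : R := (\sum_k a k + a i + a j) / 5.

(* With k the third corner, this is [(a i + a j) / 2 - a k]. *)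
Definition asym a i j : R := 3 / 2 * (a i + a j) - \sum_k a k.

Lemma sum_neqE (F : 'I_3 -> 'I_3 -> R) : (forall i, F i i = 0) ->
  \sum_i \sum_(j | i != j) F i j = \sum_i \sum_j F i j.
Proof.
move=> F0; apply: eq_bigr => i _; rewrite [RHS](bigD1 i)//= F0 add0r.
by apply: eq_bigl => j; rewrite eq_sym.
Qed.

Lemma tri_energyE a : tri_energy a = \sum_i \sum_j (a i - a j) ^+ 2.
Proof. by rewrite /tri_energy sum_neqE// => i; rewrite subrr expr0n. Qed.

Lemma tri_energy_ge0 a : 0 <= tri_energy a.
Proof. by apply: sumr_ge0 => i _; apply: sumr_ge0 => j _; exact: sqr_ge0. Qed.

Lemma tri_energy_edge a i j : 2 * (a i - a j) ^+ 2 <= tri_energy a.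
Proof.
have [->|ij] := eqVneq i j; first by rewrite subrr expr0n mulr0 tri_energy_ge0.
have [k [_ _ S]] := ord3_third R i j ij.
rewrite tri_energyE !S.
have := sqr_ge0 (a i - a k); have := sqr_ge0 (a j - a k).
rewrite !expr2; nra.
Qed.

Lemma asym_le a i j : i != j -> (asym a i j) ^+ 2 <= tri_energy a.
Proof.
move=> ij; have [k [_ _ S]] := ord3_third R i j ij.
rewrite tri_energyE /asym !S.
have := sqr_ge0 (a i - a j); have := sqr_ge0 (a i - a k).
have := sqr_ge0 (a j - a k); rewrite !expr2; nra.
Qed.

(** [on i j] marks the sides that lie on the prescribed boundary. The second square compares the
    midpoint with linear interpolation, so both squares are controlled by increments of the
    prescribed function. *)
Definition boundary_data (on : 'I_3 -> 'I_3 -> bool) a M : R :=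
  \sum_i \sum_(j | i != j)
  (on i j)%:R * ((a i - a j) ^+ 2 + (M i j - (a i + a j) / 2) ^+ 2).

Section subdivision.
Variables (a : 'I_3 -> R) (M : 'I_3 -> 'I_3 -> R).
Hypothesis (Msym : forall i j, M i j = M j i) (Mdiag : forall i, M i i = a i).

(** [M i j] is the value at corner [j] of subcell [i], that is, at the midpoint of corners [i] and
    [j]; its symmetry says that the two subcells share this vertex. *)
Let dev i j := M i j - harm a i j.

(* The harmonic extension of [a] to the subdivided triangle preserves the
   renormalized energy, so the energy gain is a quadratic form in [dev]. *)
Let gainE i j k : (forall F : 'I_3 -> R, \sum_l F l = F i + F j + F k) ->
  5 / 3 * \sum_l tri_energy (M l) - tri_energy a =
  10 / 3 * (2 * (dev i j ^+ 2 + dev i k ^+ 2 + dev j k ^+ 2) +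
   (dev i j - dev i k) ^+ 2 + (dev i j - dev j k) ^+ 2 + (dev i k - dev j k) ^+ 2).
Proof.
move=> S; rewrite !S !tri_energyE !S !Mdiag (Msym j i) (Msym k i) (Msym k j).
by rewrite /dev /harm !S; field.
Qed.

Lemma gain_ge0 : 0 <= 5 / 3 * \sum_l tri_energy (M l) - tri_energy a.
Proof.
have [k [_ _ S]] := ord3_third R (@Ordinal 3 0 isT) (@Ordinal 3 1 isT) isT.
rewrite (gainE _ _ _ S); apply: mulr_ge0; first by lra.
by repeat apply: addr_ge0; try exact: sqr_ge0; apply: mulr_ge0 => //;
  repeat apply: addr_ge0; exact: sqr_ge0.
Qed.

Lemma gain_le : 5 / 3 * \sum_l tri_energy (M l) - tri_energy a <=
  10 * \sum_i \sum_(j | i != j) (M i j - harm a i j) ^+ 2.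
Proof.
have [k [k0 k1 S]] := ord3_third R (@Ordinal 3 0 isT) (@Ordinal 3 1 isT) isT.
move: (@Ordinal 3 0 isT) (@Ordinal 3 1 isT) k0 k1 S (erefl true : (@Ordinal 3 0 isT != @Ordinal 3 1 isT)) => i j k0 k1 S ij.
rewrite (gainE _ _ _ S).
under eq_bigr do rewrite big_mkcond /=.
rewrite !S (eq_sym j i) (eq_sym i k) (eq_sym j k) ij k0 k1 !eqxx /=.
have harm_sym x y : harm a x y = harm a y x by rewrite /harm; congr (_ / _); ring.
rewrite (Msym j i) (Msym k i) (Msym k j) (harm_sym j i) (harm_sym k i) (harm_sym k j).
rewrite -/(dev i j) -/(dev i k) -/(dev j k).
have := sqr_ge0 (dev i j + dev i k); have := sqr_ge0 (dev i j + dev j k).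
have := sqr_ge0 (dev i k + dev j k); rewrite !expr2; nra.
Qed.

(** For vanishing deviations the two subcells have differences -D/2 + s/5 and -D/2 - s/5 and, up to
    sign, asymmetries 3s/10 - 3D/20 and 3s/10 + 3D/20. The mixed terms cancel in the sum; the
    coefficient of D^2 becomes 5/3 * 209/400, which stays below 24/25 after the factor 11/10, and
    that of s^2 has more room. The deviations are absorbed by the gain, a positive definite form in
    them. *)
Lemma edge_contract i j : i != j ->
  5 / 3 * (((M i i - M i j) ^+ 2 + asym (M i) i j ^+ 2 / 2) +
           ((M j i - M j j) ^+ 2 + asym (M j) i j ^+ 2 / 2)) <=
  24 / 25 * ((a i - a j) ^+ 2 + asym a i j ^+ 2 / 2)
  + 7 * (5 / 3 * \sum_l tri_energy (M l) - tri_energy a).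
Proof.
move=> ij; have [k [_ _ S]] := ord3_third R i j ij.
rewrite (gainE _ _ _ S) /asym !S !Mdiag (Msym j i).
have Mij : M i j = harm a i j + dev i j by rewrite /dev; ring.
have Mik : M i k = harm a i k + dev i k by rewrite /dev; ring.
have Mjk : M j k = harm a j k + dev j k by rewrite /dev; ring.
rewrite Mij Mik Mjk /harm !S.
move: (dev i j) (dev i k) (dev j k) (a i) (a j) (a k) => x y z ai aj ak.
pose D := aj - ai; pose s := (ai + aj) / 2 - ak.
have h1 := sqrD_le11 _ (- D / 2 + s / 5) (- x).
have h2 := sqrD_le11 _ (- D / 2 - s / 5) x.
have h3 := sqrD_le11 _ (- 3 * D / 20 + 3 * s / 10) (x / 2 - y).
have h4 := sqrD_le11 _ (3 * D / 20 + 3 * s / 10) (x / 2 - z).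
have g1 := sqr_ge0 (x + 2 * y); have g2 := sqr_ge0 (x + 2 * z).
have g3 := sqr_ge0 (x - y); have g4 := sqr_ge0 (x - z).
have g5 := sqr_ge0 (y - z).
have gx := sqr_ge0 x; have gy := sqr_ge0 y; have gz := sqr_ge0 z.
have gD := sqr_ge0 D; have gs := sqr_ge0 s.
have e1 : ai = ak + s - D / 2 by rewrite /s /D; field.
have e2 : aj = ak + s + D / 2 by rewrite /s /D; field.
rewrite e1 e2; move: D s {e1 e2} h1 h2 h3 h4 gD gs => D s.
rewrite !expr2 in g1 g2 g3 g4 g5 gx gy gz *; lra.
Qed.

Section boundary_rule.
Variable on : 'I_3 -> 'I_3 -> bool.
Hypothesis on_sym : forall i j, on i j = on j i.
Hypothesis offE : forall i j, i != j -> ~~ on i j -> M i j = harm a i j.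

Local Notation L := (boundary_data on a M).

Let L_ge0 : 0 <= L.
Proof.
apply: sumr_ge0 => i _; apply: sumr_ge0 => j _.
by rewrite mulr_ge0 ?ler0n// addr_ge0 ?sqr_ge0.
Qed.

Lemma gain_le_boundary : 5 / 3 * \sum_l tri_energy (M l) - tri_energy a <=
  20 * L + \sum_i \sum_(j | i != j) (on i j)%:R * asym a i j ^+ 2.
Proof.
apply: le_trans gain_le _; rewrite /boundary_data !mulr_sumr -big_split; apply: ler_sum => i _.
rewrite !mulr_sumr -big_split; apply: ler_sum => j ij.
have [k [_ _ S]] := ord3_third R i j ij.
case: (boolP (on i j)) => hon; last first.
  by rewrite (offE _ _ ij hon) subrr expr0n /= !mul0r !mulr0 addr0.
rewrite /= !mul1r.
have -> : M i j - harm a i j = (M i j - (a i + a j) / 2) + asym a i j / 5.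
  by rewrite /harm /asym !S; field.
have := sqrD2_le _ (M i j - (a i + a j) / 2) (asym a i j / 5).
have := sqr_ge0 (asym a i j); have := sqr_ge0 (a i - a j).
rewrite !expr2; nra.
Qed.

(** If the second side at [i] is prescribed too, as in a cell at a corner of the whole triangle, the
    asymmetry is halved up to boundary data; otherwise the harmonic rule multiplies it by 2 / 5. The
    worse case gives 11 / 10 * (1 / 2)^2 = 11 / 40. *)
Let half_contract i j : i != j -> on i j ->
  asym (M i) i j ^+ 2 <= 11 / 40 * asym a i j ^+ 2 + 22 * L.
Proof.
move=> ij oij; have [k [ki kj S]] := ord3_third R i j ij.
have ik : i != k by rewrite eq_sym.
have hL : (a i - a j) ^+ 2 + (M i j - (a i + a j) / 2) ^+ 2 +
     (on i k)%:R * (M i k - (a i + a k) / 2) ^+ 2 <= L.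
  have F0 x y : 0 <= (on x y)%:R * ((a x - a y) ^+ 2 + (M x y - (a x + a y) / 2) ^+ 2).
    by rewrite mulr_ge0 ?ler0n// addr_ge0 ?sqr_ge0.
  rewrite /boundary_data (bigD1 i)//= (bigD1 j)//= (bigD1 k)/=; last by rewrite ik kj.
  rewrite oij mul1r -!addrA !lerD2l.
  apply: (@le_trans _ _ ((on i k)%:R * ((a i - a k) ^+ 2 + (M i k - (a i + a k) / 2) ^+ 2))).
    by rewrite ler_wpM2l ?ler0n// lerDr sqr_ge0.
  rewrite lerDl addr_ge0//; first by apply: sumr_ge0 => ? _.
  by apply: sumr_ge0 => ? _; apply: sumr_ge0 => ? _.
set x := M i j - _ in hL; set y := M i k - _ in hL.
have Mij : M i j = (a i + a j) / 2 + x by rewrite /x; ring.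
have Mik : M i k = (a i + a k) / 2 + y by rewrite /y; ring.
have gD := sqr_ge0 (a i - a j); have gx := sqr_ge0 x; have gy := sqr_ge0 y.
have ga := sqr_ge0 (asym a i j).
have -> : asym (M i) i j = (a i + M i j) / 2 - M i k.
  by rewrite /asym S Mdiag; field.
case: (boolP (on i k)) => oik; rewrite ?(negbTE oik) ?oik ?mul1r ?mul0r ?addr0 in hL.
- have -> : (a i + M i j) / 2 - M i k = asym a i j / 2 + (x / 2 - y).
    by rewrite Mij Mik /asym S; field.
  have h1 := sqrD_le11 _ (asym a i j / 2) (x / 2 - y).
  have h2 := sqr_ge0 (x / 2 + y).
  rewrite !expr2 in hL gD gx gy ga h1 h2 *; nra.
- have -> : (a i + M i j) / 2 - M i k = 2 / 5 * asym a i j + (3 / 20 * (a i - a j) + x / 2).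
    by rewrite (offE _ _ ik oik) Mij /harm /asym !S; field.
  have h1 := sqrD_le11 _ (2 / 5 * asym a i j) (3 / 20 * (a i - a j) + x / 2).
  have h2 := sqr_ge0 (3 / 20 * (a i - a j) - x / 2).
  rewrite !expr2 in hL gD gx gy ga h1 h2 *; nra.
Qed.

(** Only the subcells at [i] and [j] keep touching the side: 5 / 3 * 2 * 11 / 40 = 11 / 12. Each of
    the six ordered pairs contributes the error 5 / 3 * 2 * 22 = 220 / 3, in total 440. *)
Lemma boundary_contract :
  5 / 3 * \sum_l \sum_i \sum_(j | i != j)
     (on i j && ((l == i) || (l == j)))%:R * asym (M l) i j ^+ 2 <=
  11 / 12 * \sum_i \sum_(j | i != j) (on i j)%:R * asym a i j ^+ 2 + 440 * L.
Proof.
have asymC b i j : asym b i j = asym b j i by rewrite /asym addrC (addrC (b j)); ring.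
move: (L) half_contract L_ge0 => L' hc L'0.
have -> : 440 * L' = \sum_(i : 'I_3) \sum_(j : 'I_3 | i != j) (220 / 3 * L').
  under eq_bigr do rewrite big_mkcond /=.
  by rewrite !big_ord_recl !big_ord0 /=; field.
rewrite exchange_big /= !mulr_sumr -big_split /=; apply: ler_sum => i _.
rewrite exchange_big /= !mulr_sumr -big_split /=; apply: ler_sum => j ij.
have [k [ki kj S]] := ord3_third R i j ij.
rewrite !S !eqxx !orbT (negbTE ki) (negbTE kj) /= andbF mul0r addr0.
case: (boolP (on i j)) => oij; rewrite /= ?mul0r ?mul1r; last by lra.
have h1 := hc _ _ ij oij.
have h2 : asym (M j) i j ^+ 2 <= 11 / 40 * asym a i j ^+ 2 + 22 * L'.
  by rewrite asymC (asymC a); apply: hc; rewrite 1?eq_sym// on_sym.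
lra.
Qed.

End boundary_rule.
End subdivision.
End triangle.

(** * Functions on the vertices of all cells *)

Section words.
Variable R : realType.
Implicit Types (F G : seq 'I_3 -> R) (v w : seq 'I_3) (i j : 'I_3).

Fixpoint wsum (n : nat) G : R :=
  if n is n'.+1 then \sum_(i : 'I_3) wsum n' (fun s => G (i :: s)) else G [::].

Lemma wsumE n G : \sum_(w : n.-tuple 'I_3) G w = wsum n G.
Proof.
elim: n G => [|n IH] G /=.
  by rewrite (big_pred1 [tuple]) // => w; apply/esym/eqP; exact: tuple0.
under [RHS]eq_bigr do rewrite -IH.
rewrite pair_big /= (reindex (fun p : 'I_3 * n.-tuple 'I_3 => [tuple of p.1 :: p.2])) //=.
exists (fun w : n.+1.-tuple 'I_3 => (thead w, [tuple of behead w])) => [[i w] _|w _] /=.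
  by congr pair; apply: val_inj.
by rewrite -tuple_eta.
Qed.

Lemma eq_wsum n F G : (forall w, size w = n -> F w = G w) -> wsum n F = wsum n G.
Proof.
elim: n F G => [|n IH] F G h /=; first exact: h.
by apply: eq_bigr => i _; apply: IH => w sw; apply: h; rewrite /= sw.
Qed.

Lemma le_wsum n F G : (forall w, size w = n -> F w <= G w) -> wsum n F <= wsum n G.
Proof.
elim: n F G => [|n IH] F G h /=; first exact: h.
by apply: ler_sum => i _; apply: IH => w sw; apply: h; rewrite /= sw.
Qed.

Lemma wsum_ge0 n G : (forall w, 0 <= G w) -> 0 <= wsum n G.
Proof.
elim: n G => [|n IH] G h /=; first exact: h.
by apply: sumr_ge0 => i _; apply: IH.
Qed.

Lemma wsum_ge_term n G w : (forall w, 0 <= G w) -> size w = n -> G w <= wsum n G.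
Proof.
elim: n G w => [|n IH] G [|i w] h //= [sw].
rewrite (bigD1 i)//= -[leLHS]addr0 lerD//; last by apply: sumr_ge0 => *; exact: wsum_ge0.
exact: (IH (fun s => G (i :: s))).
Qed.

Lemma wsumSr n G : wsum n.+1 G = wsum n (fun w => \sum_i G (rcons w i)).
Proof.
elim: n G => [|n IH] G //.
transitivity (\sum_i wsum n.+1 (fun s => G (i :: s))) => //.
by under eq_bigr do rewrite IH.
Qed.

Lemma wsum_add m n G : wsum (m + n) G = wsum m (fun w => wsum n (fun v => G (w ++ v))).
Proof.
elim: m G => [|m IH] G //=; apply: eq_bigr => i _; exact: IH.
Qed.

Lemma wsumD n F G : wsum n (fun w => F w + G w) = wsum n F + wsum n G.
Proof. by elim: n F G => [|n IH] F G //=; rewrite -big_split; apply: eq_bigr. Qed.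

Lemma wsumZ n c G : wsum n (fun w => c * G w) = c * wsum n G.
Proof. by elim: n G => [|n IH] G //=; rewrite mulr_sumr; apply: eq_bigr. Qed.

Lemma wsum_sum n (I : finType) (P : pred I) (G : I -> seq 'I_3 -> R) :
  wsum n (fun w => \sum_(i | P i) G i w) = \sum_(i | P i) wsum n (G i).
Proof.
elim: n G => [|n IH] G //=; rewrite [RHS]exchange_big; apply: eq_bigr => i _; exact: IH.
Qed.

(* The letters are the binary digits of k, so that k runs along the side from
   corner i to corner j. *)
Fixpoint side_word i j n k : seq 'I_3 :=
  if n is n'.+1 then rcons (side_word i j n' k./2) (if odd k then j else i) else [::].

Lemma size_side_word i j n k : size (side_word i j n k) = n.
Proof. by elim: n k => //= n IH k; rewrite size_rcons IH. Qed.

Definition on_side v i j : bool := all (fun l => (l == i) || (l == j)) v.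

Lemma on_sideC v i j : on_side v i j = on_side v j i.
Proof. by apply: eq_all => l; rewrite orbC. Qed.

Lemma on_side_rcons v l i j : on_side (rcons v l) i j = on_side v i j && ((l == i) || (l == j)).
Proof. by rewrite /on_side all_rcons andbC. Qed.

Lemma on_side_word i j n k : on_side (side_word i j n k) i j.
Proof.
elim: n k => //= n IH k; rewrite on_side_rcons IH /=.
by case: odd; rewrite eqxx ?orbT.
Qed.

Lemma wsum_on_side i j n G : i != j ->
  wsum n (fun v => (on_side v i j)%:R * G v) = \sum_(k < 2 ^ n) G (side_word i j n k).
Proof.
move=> ij; elim: n G => [|n IH] G; first by rewrite /= big_ord1 mul1r.
rewrite wsumSr expnS mul2n (sum_double _ _ (fun k => G (side_word i j n.+1 k))) /=.
rewrite (eq_bigr (fun k : 'I_(2 ^ n) => (fun v => G (rcons v i) + G (rcons v j)) (side_word i j n k))).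
  rewrite -(IH (fun v => G (rcons v i) + G (rcons v j))).
  apply: eq_wsum => v _; have [k [ki kj S]] := ord3_third R i j ij.
  rewrite S !on_side_rcons !eqxx !orbT /= (negbTE ki) (negbTE kj) /= andbF mul0r addr0 andbT.
  by rewrite mulrDr.
by move=> k _ /=; rewrite odd_double /= doubleK uphalf_double.
Qed.

Lemma sum_side_le i j n G : i != j -> (forall v, 0 <= G v) ->
  \sum_(k < 2 ^ n) G (side_word i j n k) <= wsum n G.
Proof.
move=> ij G0; rewrite -wsum_on_side//; apply: le_wsum => v _.
by case: on_side; rewrite ?mul1r ?mul0r.
Qed.

(** [u w j] is the value at corner [j] of cell [w]. The clauses express that neighbouring subcells
    share a midpoint and that a corner survives subdivision. *)
Definition compatible (u : seq 'I_3 -> 'I_3 -> R) :=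
  (forall w i j, u (rcons w i) j = u (rcons w j) i) /\
  (forall w i, u (rcons w i) i = u w i).

Definition renergy (u : seq 'I_3 -> 'I_3 -> R) n : R :=
  (5 / 3) ^+ n * wsum n (fun w => tri_energy R (u w)).

Let c53 n : 0 <= (5 / 3 : R) ^+ n. Proof. by apply: exprn_ge0; lra. Qed.

Lemma renergyS u n : renergy u n.+1 = renergy u n + (5 / 3) ^+ n *
  wsum n (fun w => 5 / 3 * \sum_l tri_energy R (u (rcons w l)) - tri_energy R (u w)).
Proof.
have -> : wsum n (fun w => 5 / 3 * \sum_l tri_energy R (u (rcons w l)) - tri_energy R (u w))
  = 5 / 3 * wsum n (fun w => \sum_l tri_energy R (u (rcons w l))) - wsum n (fun w => tri_energy R (u w)).
  rewrite -wsumZ -mulN1r -wsumZ -wsumD; apply: eq_wsum => w _; by rewrite mulN1r.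
by rewrite /renergy exprS wsumSr; ring.
Qed.

Lemma gain_word_ge0 u w : compatible u ->
  0 <= 5 / 3 * \sum_l tri_energy R (u (rcons w l)) - tri_energy R (u w).
Proof.
move=> [us ud].
apply: (gain_ge0 R (u w) (fun i j => u (rcons w i) j)) => *; [exact: us|exact: ud].
Qed.

Lemma renergy_nondecreasing u : compatible u -> nondecreasing_seq (renergy u).
Proof.
move=> cu; apply/nondecreasing_seqP => n; rewrite renergyS lerDl mulr_ge0//.
by apply: wsum_ge0 => w; exact: gain_word_ge0.
Qed.

Lemma renergy_edge u n w i j : size w = n -> (5 / 3) ^+ n * (u w i - u w j) ^+ 2 <= renergy u n.
Proof.
move=> sw; apply: ler_wpM2l => //.
apply: (le_trans _ (wsum_ge_term n _ w _ sw)) => [|v]; last exact: tri_energy_ge0.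
by have := tri_energy_edge R (u w) i j; have := sqr_ge0 (u w i - u w j); lra.
Qed.

Lemma renergy_sub u m n w : size w = m ->
  (5 / 3) ^+ m * renergy (fun v => u (w ++ v)) n <= renergy u (m + n).
Proof.
move=> sw; rewrite /renergy mulrA -exprD wsum_add; apply: ler_wpM2l => //.
apply: (wsum_ge_term m (fun w => wsum n (fun v => tri_energy R (u (w ++ v))))) => // v.
by apply: wsum_ge0 => *; exact: tri_energy_ge0.
Qed.

Lemma compatible_sub u w : compatible u -> compatible (fun v => u (w ++ v)).
Proof. by move=> [us ud]; split=> *; rewrite -!rcons_cat; [exact: us | exact: ud]. Qed.

(** [edge_contract] is summed along the side; the gains there are part of the total gain, which
    telescopes. The constant is 25 * (2 + 7), with 25 = 1 / (1 - 24 / 25). *)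
Lemma side_trace u i j (B : R) : compatible u -> i != j -> (forall n, renergy u n <= B) ->
  forall N, \sum_(n < N) (5 / 3) ^+ n *
     \sum_(k < 2 ^ n) (u (side_word i j n k) i - u (side_word i j n k) j) ^+ 2 <= 225 * B.
Proof.
move=> cu ij uB N; have [us ud] := cu.
pose Q (a : 'I_3 -> R) := (a i - a j) ^+ 2 + asym R a i j ^+ 2 / 2.
pose T n := (5 / 3) ^+ n * \sum_(k < 2 ^ n) Q (u (side_word i j n k)).
pose gain w := 5 / 3 * \sum_l tri_energy R (u (rcons w l)) - tri_energy R (u w).
pose a n := renergy u n.+1 - renergy u n.
have Q0 b : 0 <= Q b by rewrite addr_ge0 ?divr_ge0 ?sqr_ge0.
have : (1 - 24 / 25) * \sum_(n < N) T n <= T 0 + 7 * \sum_(n < N) a n.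
  apply: sum_contract_fwd; first lra.
    by move=> n; rewrite mulr_ge0// sumr_ge0.
  move=> n; rewrite /T /a renergyS addrAC subrr add0r exprS.
  rewrite expnS mul2n (sum_double _ _ (fun k => Q (u (side_word i j n.+1 k)))).
  have -> x y : 24 / 25 * ((5 / 3) ^+ n * x) + 7 * ((5 / 3) ^+ n * y) =
    (5 / 3) ^+ n * (24 / 25 * x + 7 * y) :> R by ring.
  have -> z : 5 / 3 * (5 / 3) ^+ n * z = (5 / 3) ^+ n * (5 / 3 * z) :> R by ring.
  apply: ler_wpM2l => //.
  have := sum_side_le i j n gain ij (fun w => gain_word_ge0 u w cu).
  move=> /(ler_wpM2l (ler0n R 7)) h; apply: (le_trans _ (lerD (lexx _) h)).
  rewrite !mulr_sumr -big_split; apply: ler_sum => k _ /=.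
  rewrite odd_double /= doubleK uphalf_double.
  move: (side_word i j n k) => w.
  exact: (edge_contract R (u w) (fun i j => u (rcons w i) j) (us w) (ud w) i j ij).
have -> : \sum_(n < N) a n = renergy u N - renergy u 0.
  elim: (N) => [|n IH]; first by rewrite big_ord0 subrr.
  by rewrite big_ord_recr /= IH /a; ring.
have T0 : T 0 <= 2 * renergy u 0.
  rewrite /T /renergy !expr0 !mul1r /= big_ord1 /= /Q.
  have := tri_energy_edge R (u [::]) i j; have := asym_le R (u [::]) i j ij.
  have := tri_energy_ge0 R (u [::]); have := sqr_ge0 (u [::] i - u [::] j); lra.
have B0 : 0 <= renergy u 0.
  by rewrite mulr_ge0// wsum_ge0// => w; exact: tri_energy_ge0.
move=> h; have uN := uB N; have u0 := uB 0.
have {h} h : \sum_(n < N) T n <= 225 * B by lra.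
apply: le_trans h; apply: ler_sum => n _; apply: ler_wpM2l => //.
by apply: ler_sum => k _; rewrite /Q lerDl divr_ge0 ?sqr_ge0.
Qed.

End words.

(** * The extension from the sides of a triangle *)

Lemma sum_pairs_sym (R : realFieldType) (F : 'I_3 -> 'I_3 -> R) :
  (forall i j, F i j = F j i) ->
  \sum_i \sum_(j | i != j) F i j = 2 * \sum_(i : 'I_3) \sum_(j : 'I_3 | (i < j)%N) F i j.
Proof.
move=> FC; under eq_bigr do rewrite big_mkcond /=.
under [in RHS]eq_bigr do rewrite big_mkcond /=.
rewrite !big_ord_recl !big_ord0 /=.
rewrite (FC (lift ord0 ord0) ord0) (FC (lift ord0 (lift ord0 ord0)) ord0).
by rewrite (FC (lift ord0 (lift ord0 ord0)) (lift ord0 ord0)); ring.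
Qed.

Section gasket.
Variable R : realType.
Variable q : 'I_3 -> 'rV[R]_2.
Local Notation pt := 'rV[R]_2.
Local Notation Phi := (Phi q).
Local Notation Phiw := (Phiw q).
Implicit Types (f phi : pt -> R) (v w s : seq 'I_3) (i j : 'I_3).

Definition side i j (t : R) : pt := q i + t *: (q j - q i).

Lemma PhiC i j : Phi i (q j) = Phi j (q i).
Proof. by rewrite /Defs.Phi addrC. Qed.

Lemma Phi_fix i : Phi i (q i) = q i.
Proof. by apply/rowP => l; rewrite !mxE; field. Qed.

Lemma side0 i j : side i j 0 = q i.
Proof. by rewrite /side scale0r addr0. Qed.

Lemma side1 i j : side i j 1 = q j.
Proof. by rewrite /side scale1r addrC subrK. Qed.

Lemma Phi_side_l i j t : Phi i (side i j t) = side i j (t / 2).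
Proof. by apply/rowP => l; rewrite !mxE; field. Qed.

Lemma Phi_side_r i j t : Phi j (side i j t) = side i j ((t + 1) / 2).
Proof. by apply/rowP => l; rewrite !mxE; field. Qed.

Lemma Phiw_rcons w i x : Phiw (rcons w i) x = Phiw w (Phi i x).
Proof. by elim: w => //= l w ->. Qed.

Lemma Phiw_cat w v x : Phiw (w ++ v) x = Phiw w (Phiw v x).
Proof. by elim: w => //= l w ->. Qed.

Lemma side_wordP i j n k t : (k < 2 ^ n)%N ->
  Phiw (side_word i j n k) (side i j t) = side i j ((k%:R + t) / 2 ^+ n).
Proof.
elim: n k t => [|n IH] k t lt /=.
  by move: lt; rewrite expn0 ltnS leqn0 => /eqP ->; rewrite add0r divr1.
have lt2 : (k./2 < 2 ^ n)%N by move: lt; rewrite expnS; lia.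
have z : (2 : R) ^+ n != 0 by rewrite expf_neq0.
have ek : k%:R = (odd k)%:R + k./2%:R * 2 :> R.
  by rewrite -natrM muln2 -natrD odd_double_half.
rewrite Phiw_rcons ek exprS; case: (odd k).
- by rewrite Phi_side_r IH// mulr1n; congr side; field.
- by rewrite Phi_side_l IH// mulr0n; congr side; field.
Qed.

Lemma on_side_point v i j t : on_side v i j -> 0 <= t <= 1 ->
  exists2 t', 0 <= t' <= 1 & Phiw v (side i j t) = side i j t'.
Proof.
move=> + t01; elim: v => [|l v IH] /=; first by exists t.
move=> /andP[lij /IH[t' /andP[t0 t1] ->]]; case/orP: lij => /eqP ->.
- by exists (t' / 2); [apply/andP; split; lra | exact: Phi_side_l].
- by exists ((t' + 1) / 2); [apply/andP; split; lra | exact: Phi_side_r].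
Qed.

(* [s] is the address of the cell read backwards, so that the head is the last
   subdivision.  The midpoint of corners i and j of a cell lies on a side of the
   whole triangle exactly when the address only uses the letters i and j. *)
Fixpoint ext phi s j : R :=
  if s is i :: s' then
    if i == j then ext phi s' i
    else if on_side s' i j then phi (Phiw (rev s') (Phi i (q j)))
    else (\sum_k ext phi s' k + ext phi s' i + ext phi s' j) / 5
  else phi (q j).

Definition uext phi v j := ext phi (rev v) j.

Lemma on_side_rev v i j : on_side (rev v) i j = on_side v i j.
Proof. by rewrite /on_side all_rev. Qed.

Lemma uext_rcons phi v i j : i != j -> uext phi (rcons v i) j =
  if on_side v i j then phi (Phiw v (Phi i (q j))) else harm R (uext phi v) i j.
Proof. by move=> ij; rewrite /uext rev_rcons /= (negbTE ij) on_side_rev revK. Qed.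

Lemma uext_compatible phi : compatible R (uext phi).
Proof.
split=> [w i j|w i]; last by rewrite /uext rev_rcons /= eqxx.
have [->//|ij] := eqVneq i j.
rewrite !uext_rcons// 1?eq_sym// on_sideC PhiC; case: ifP => // _.
by rewrite /harm; congr (_ / _); ring.
Qed.

Lemma uext_side phi v i j : on_side v i j -> uext phi v i = phi (Phiw v (q i)).
Proof.
elim/last_ind: v => [//|v l IH]; rewrite on_side_rcons => /andP[vij].
have [-> _|li /= /eqP lj] := eqVneq l i.
  by rewrite (proj2 (uext_compatible phi)) Phiw_rcons Phi_fix; exact: IH.
by rewrite uext_rcons// lj on_sideC vij Phiw_rcons.
Qed.

Lemma uextD phi psi (a b : R) v j :
  uext (fun x => a * phi x + b * psi x) v j = a * uext phi v j + b * uext psi v j.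
Proof.
rewrite /uext; elim: (rev v) j => [//|l s IH] j /=; case: eqP => // _.
case: ifP => // _; rewrite !IH.
have -> : \sum_k ext (fun x => a * phi x + b * psi x) s k =
   a * \sum_k ext phi s k + b * \sum_k ext psi s k.
  by rewrite !mulr_sumr -big_split; apply: eq_bigr.
by field.
Qed.

(** The recursion evaluates [phi] only at points of the sides. This is why the extension depends on
    nothing but the values on the graph. *)
Lemma eq_uext phi psi v j :
  (forall i j t, 0 <= t <= 1 -> phi (side i j t) = psi (side i j t)) ->
  uext phi v j = uext psi v j.
Proof.
move=> h; rewrite /uext; elim: (rev v) j => [|l s IH] j /=.
  by rewrite -(side0 j j); apply: h; rewrite lexx ler01.
case: eqP => // _; case: ifP => os.
  rewrite -(side1 l j) Phi_side_l.
  have [||t' t01 ->] := on_side_point (rev s) l j (1 / 2).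
  - by rewrite on_side_rev.
  - by apply/andP; split; lra.
  exact: h.
by under eq_bigr do rewrite IH; rewrite !IH.
Qed.

Section energy.
Variable phi : pt -> R.

Let c53 n : 0 <= (5 / 3 : R) ^+ n. Proof. by apply: exprn_ge0; lra. Qed.

Definition side_sum i j n : R := (5 / 3) ^+ n * \sum_(k < 2 ^ n)
  (phi (side i j (k.+1%:R / 2 ^+ n)) - phi (side i j (k%:R / 2 ^+ n))) ^+ 2.

Let L v := boundary_data R (on_side v) (uext phi v) (fun i j => uext phi (rcons v i) j).

Let t i j v : R := (on_side v i j)%:R *
  ((uext phi v i - uext phi v j) ^+ 2 +
   (uext phi (rcons v i) j - (uext phi v i + uext phi v j) / 2) ^+ 2).

Let side_sum_ge0 i j n : 0 <= side_sum i j n.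
Proof. by rewrite mulr_ge0// sumr_ge0// => k _; exact: sqr_ge0. Qed.

(** The midpoint value minus the average of the endpoints is half the difference of the two
    increments at the next level. *)
Let t_le i j n : i != j -> (5 / 3) ^+ n * wsum R n (t i j) <= side_sum i j n + side_sum i j n.+1.
Proof.
move=> ij; rewrite /t (wsum_on_side R i j n (fun v => (uext phi v i - uext phi v j) ^+ 2 +
   (uext phi (rcons v i) j - (uext phi v i + uext phi v j) / 2) ^+ 2))//.
rewrite /side_sum exprS -mulrA (mulrCA (5 / 3)) -mulrDr; apply: ler_wpM2l => //.
rewrite exprS expnS mul2n (sum_double _ _ (fun k => (phi (side i j (k.+1%:R / (2 * 2 ^+ n))) -
  phi (side i j (k%:R / (2 * 2 ^+ n)))) ^+ 2)).
rewrite mulr_sumr -big_split; apply: ler_sum => k _ /=.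
set w := side_word i j n k.
have ow : on_side w i j by exact: on_side_word.
have z : (2 : R) ^+ n != 0 by rewrite expf_neq0.
have ui : uext phi w i = phi (side i j (k%:R / 2 ^+ n)).
  by rewrite (uext_side _ _ _ _ ow) -(side0 i j) side_wordP ?addr0.
have uj : uext phi w j = phi (side i j (k.+1%:R / 2 ^+ n)).
  by rewrite (uext_side _ _ j i) 1?on_sideC// -(side1 i j) side_wordP// natr1.
have um : uext phi (rcons w i) j = phi (side i j (k.*2.+1%:R / (2 * 2 ^+ n))).
  rewrite uext_rcons// ow -(side1 i j) Phi_side_l side_wordP//; congr (phi (side i j _)).
  have -> : k.*2.+1%:R = k%:R * 2 + 1 :> R by rewrite -natrM muln2 natr1.
  by field.
have -> : k.*2%:R / (2 * 2 ^+ n) = k%:R / 2 ^+ n :> R.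
  by rewrite -muln2 natrM; field.
have -> : k.*2.+2%:R / (2 * 2 ^+ n) = k.+1%:R / 2 ^+ n :> R.
  by rewrite -doubleS -muln2 natrM; field.
rewrite ui uj um.
move: (phi _) (phi _) (phi _) => x y z'.
have := sqr_ge0 (x - y); have := sqr_ge0 (z' - x); have := sqr_ge0 (y - z').
by rewrite !expr2; nra.
Qed.

Let LE n : (5 / 3) ^+ n * wsum R n L = 2 * \sum_(i : 'I_3) \sum_(j : 'I_3 | (i < j)%N) (5 / 3) ^+ n * wsum R n (t i j).
Proof.
have tC i j v : t i j v = t j i v.
  rewrite /t on_sideC (proj1 (uext_compatible phi)) -sqrrN opprB.
  by rewrite (addrC (uext phi v i)).
rewrite /L /boundary_data -/(t _ _) wsum_sum.
under eq_bigr do rewrite wsum_sum.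
rewrite (sum_pairs_sym _ (fun i j => wsum R n (t i j))).
  rewrite mulrCA mulr_sumr; congr (_ * _); apply: eq_bigr => i _; by rewrite mulr_sumr.
by move=> i j; apply: eq_wsum => v _; exact: tC.
Qed.

Let sumL N : \sum_(n < N.+1) (5 / 3) ^+ n * wsum R n L <=
  4 * \sum_(i : 'I_3) \sum_(j : 'I_3 | (i < j)%N) \sum_(n < N.+2) side_sum i j n.
Proof.
under eq_bigr do rewrite LE.
rewrite -mulr_sumr exchange_big /=.
under eq_bigr do rewrite exchange_big /=.
rewrite (_ : 4 = 2 * 2); last by rewrite -natrM.
rewrite -mulrA; apply: ler_wpM2l => //.
rewrite mulr_sumr; apply: ler_sum => i _; rewrite mulr_sumr; apply: ler_sum => j ij.
have nij : i != j by apply: contraTneq ij => ->; rewrite ltnn.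
apply: (@le_trans _ _ (\sum_(n < N.+1) (side_sum i j n + side_sum i j n.+1))).
  by apply: ler_sum => n _; exact: t_le.
rewrite big_split /=.
have h1 : \sum_(n < N.+1) side_sum i j n <= \sum_(n < N.+2) side_sum i j n.
  by rewrite [leRHS]big_ord_recr /= lerDl.
have h2 : \sum_(n < N.+1) side_sum i j n.+1 <= \sum_(n < N.+2) side_sum i j n.
  by rewrite [leRHS]big_ord_recl /= lerDr.
lra.
Qed.

Let L0 v : 0 <= L v.
Proof.
apply: sumr_ge0 => i _; apply: sumr_ge0 => j _.
by rewrite mulr_ge0 ?ler0n// addr_ge0 ?sqr_ge0.
Qed.

Let psi v := \sum_i \sum_(j | i != j) (on_side v i j)%:R * asym R (uext phi v) i j ^+ 2.

Let off v i j : i != j -> ~~ on_side v i j -> uext phi (rcons v i) j = harm R (uext phi v) i j.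
Proof. by move=> ij /negbTE o; rewrite uext_rcons// o. Qed.

Let symu v i j : uext phi (rcons v i) j = uext phi (rcons v j) i.
Proof. exact: (proj1 (uext_compatible phi)). Qed.

Let diagu v i : uext phi (rcons v i) i = uext phi v i.
Proof. exact: (proj2 (uext_compatible phi)). Qed.

(** In the constant, 1 accounts for the initial energy, 20 for the boundary data in each gain, and
    12 = 1 / (1 - 11 / 12) for the asymmetries, with initial value 6 and error 440. The 4 comes from
    ordered pairs and from using two consecutive levels of increments. *)
Lemma uext_energy N : renergy R (uext phi) N <= (1 + (20 + 12 * (6 + 440))) * 4 *
   \sum_(i : 'I_3) \sum_(j : 'I_3 | (i < j)%N) \sum_(n < N.+2) side_sum i j n.
Proof.
pose Ls n := (5 / 3) ^+ n * wsum R n L.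
pose Ps n := (5 / 3) ^+ n * wsum R n psi.
have Ls0 n : 0 <= Ls n by rewrite mulr_ge0// wsum_ge0.
have psi0 v : 0 <= psi v.
  by apply: sumr_ge0 => i _; apply: sumr_ge0 => j _; rewrite mulr_ge0 ?ler0n ?sqr_ge0.
have contr : (1 - 11 / 12) * \sum_(n < N) Ps n <= Ps 0 + 440 * \sum_(n < N) Ls n.
  apply: sum_contract_fwd; first lra.
    by move=> n; rewrite mulr_ge0// wsum_ge0.
  move=> n; rewrite /Ps /Ls wsumSr exprS.
  have -> x y : 11 / 12 * ((5 / 3) ^+ n * x) + 440 * ((5 / 3) ^+ n * y) =
    (5 / 3) ^+ n * (11 / 12 * x + 440 * y) :> R by ring.
  have -> z : 5 / 3 * (5 / 3) ^+ n * z = (5 / 3) ^+ n * (5 / 3 * z) :> R by ring.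
  apply: ler_wpM2l => //; rewrite -!wsumZ -wsumD; apply: le_wsum => v _.
  apply: (le_trans _ (boundary_contract R (uext phi v)
    (fun i j => uext phi (rcons v i) j) (diagu v) (on_side v)
    (on_sideC v) (off v))).
  rewrite le_eqVlt; apply/orP; left; apply/eqP; congr (_ * _); apply: eq_bigr => l _.
  by apply: eq_bigr => i _; apply: eq_bigr => j _; rewrite on_side_rcons.
have gain : renergy R (uext phi) N <= renergy R (uext phi) 0 + 20 * \sum_(n < N) Ls n + \sum_(n < N) Ps n.
  elim: (N) => [|n IH]; first by rewrite !big_ord0 mulr0 !addr0.
  rewrite renergyS !big_ord_recr /=.
  have : (5 / 3) ^+ n * wsum R n (fun w => 5 / 3 * \sum_l tri_energy R (uext phi (rcons w l))
       - tri_energy R (uext phi w)) <= 20 * Ls n + Ps n.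
    rewrite /Ls /Ps mulrCA -mulrDr; apply: ler_wpM2l => //.
    rewrite -wsumZ -wsumD; apply: le_wsum => v _.
    exact: (gain_le_boundary R (uext phi v)
      (fun i j => uext phi (rcons v i) j) (symu v) (diagu v) (on_side v) (off v)).
  by move: IH; lra.
have E0 : renergy R (uext phi) 0 <= Ls 0.
  rewrite /renergy /Ls !expr0 !mul1r /= /L /boundary_data.
  apply: ler_sum => i _; apply: ler_sum => j _; rewrite /= mul1r lerDl; exact: sqr_ge0.
have P0 : Ps 0 <= 6 * Ls 0.
  apply: le_trans (ler_wpM2l (ler0n R 6) E0).
  rewrite /renergy /Ps !expr0 !mul1r /= /psi.
  apply: (@le_trans _ _ (\sum_(i : 'I_3) \sum_(j : 'I_3 | i != j) tri_energy R (uext phi [::]))).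
    apply: ler_sum => i _; apply: ler_sum => j ij; rewrite /= mul1r; exact: asym_le.
  under eq_bigr do rewrite big_mkcond /=.
  by rewrite !big_ord_recl !big_ord0 /=; lra.
have l0 : Ls 0 <= \sum_(n < N.+1) Ls n.
  by rewrite big_ord_recl /= lerDl sumr_ge0.
have lN : \sum_(n < N) Ls n <= \sum_(n < N.+1) Ls n.
  by rewrite [leRHS]big_ord_recr /= lerDl.
have hS : \sum_(n < N.+1) Ls n <= 4 * \sum_(i : 'I_3) \sum_(j : 'I_3 | (i < j)%N)
    \sum_(n < N.+2) side_sum i j n := sumL N.
have le3 (e e0 y z p0 l x s : R) : (1 - 11 / 12) * z <= p0 + 440 * y ->
    e <= e0 + 20 * y + z -> e0 <= l -> p0 <= 6 * l -> l <= x -> y <= x -> x <= 4 * s ->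
    e <= (1 + (20 + 12 * (6 + 440))) * 4 * s by lra.
exact: le3 contr gain E0 P0 l0 lN hS.
Qed.

End energy.
End gasket.

(** * From vertex values to continuous functions on the gasket *)

Section barycentric.
Variables (R : realType) (q : 'I_3 -> 'rV[R]_2).
Hypothesis hq : forall i j : 'I_3, i != j -> eucl_dist (q i) (q j) = 1.
Implicit Types (i j k : 'I_3) (x : 'rV[R]_2).

(* Barycentric coordinates: the inner product of [x - g] and [2 (q k - g)],
   shifted by 1/3, where [g] is the center of the triangle. *)
Definition bary k x : R := 3^-1 + 2 * \sum_(c < 2)
  (x ord0 c - (\sum_l q l ord0 c) / 3) * (q k ord0 c - (\sum_l q l ord0 c) / 3).

Let sum2 (F : 'I_2 -> R) : \sum_c F c = F ord0 + F ord_max.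
Proof. by rewrite !big_ord_recl big_ord0 addr0; congr (_ + F _); apply: val_inj. Qed.

Let distE i j : i != j ->
  (q i ord0 ord0 - q j ord0 ord0) ^+ 2 + (q i ord0 ord_max - q j ord0 ord_max) ^+ 2 = 1.
Proof.
move=> ij; have := hq _ _ ij; rewrite /eucl_dist => h.
rewrite -[RHS](expr1n _ 2) -h sqr_sqrtr// addr_ge0 ?sqr_ge0//.
Qed.

Lemma baryE k x : bary k x = 3^-1 + 2 *
  ((x ord0 ord0 - (\sum_l q l ord0 ord0) / 3) * (q k ord0 ord0 - (\sum_l q l ord0 ord0) / 3) +
  (x ord0 ord_max - (\sum_l q l ord0 ord_max) / 3) * (q k ord0 ord_max - (\sum_l q l ord0 ord_max) / 3)).
Proof. by rewrite /bary sum2. Qed.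

Lemma bary_sum x : \sum_k bary k x = 1.
Proof.
have [k [_ _ S]] := ord3_third R (@Ordinal 3 0 isT) (@Ordinal 3 1 isT) isT.
by rewrite S /bary !sum2 !S; field.
Qed.

Lemma bary_vertex k i : bary k (q i) = (k == i)%:R.
Proof.
have [->|ki] := eqVneq k i.
  have [j ji] : exists j, i != j.
    case: i => [[|[|[|]]]//= p]; by [exists (@Ordinal 3 1 isT) | exists (@Ordinal 3 0 isT)].
  have [l [li lj S]] := ord3_third R i j ji.
  have := distE _ _ ji; have := distE _ _ li; have := distE _ _ lj.
  rewrite /bary sum2 !S !expr2 /=; lra.
have [l [lk li S]] := ord3_third R k i ki.
have := distE _ _ ki; have := distE _ _ lk; have := distE _ _ li.
rewrite /bary sum2 !S !expr2 /=; lra.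
Qed.

Lemma bary_Phi k i x : bary k (Phi q i x) = (bary k x + (k == i)%:R) / 2.
Proof. by rewrite -bary_vertex /bary !sum2 !mxE; field. Qed.

(** Equal coordinates make [x - q i] orthogonal to two sides of the triangle, and these are
    independent: their squared determinant is 3 / 4 by the Gram identity. *)
Lemma bary_inj x i : (forall k, bary k x = (k == i)%:R) -> x = q i.
Proof.
move=> h; have {}h k : bary k x = bary k (q i) by rewrite h bary_vertex.
have [j ij] : exists j, i != j.
  case: (i) => [[|[|[|]]]//= p]; by [exists (@Ordinal 3 1 isT) | exists (@Ordinal 3 0 isT)].
have [l [li lj S]] := ord3_third R i j ij.
have := distE _ _ ij; have := distE _ _ li; have := distE _ _ lj.
have := h i; have := h j; have := h l; rewrite /bary !sum2 !S.
set a0 := q i ord0 ord0; set a1 := q i ord0 ord_max.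
set b0 := q j ord0 ord0; set b1 := q j ord0 ord_max.
set c0 := q l ord0 ord0; set c1 := q l ord0 ord_max.
set y0 := x ord0 ord0; set y1 := x ord0 ord_max => h1 h2 h3 d1 d2 d3.
pose D := (b0 - a0) * (c1 - a1) - (b1 - a1) * (c0 - a0).
have e1 : (b0 - a0) * (y0 - a0) + (b1 - a1) * (y1 - a1) = 0 by move: h1 h2 h3; lra.
have e2 : (c0 - a0) * (y0 - a0) + (c1 - a1) * (y1 - a1) = 0 by move: h1 h2 h3; lra.
have D2 : D ^+ 2 = 3 / 4.
  have uv : (b0 - a0) * (c0 - a0) + (b1 - a1) * (c1 - a1) = 1 / 2.
    by move: d1 d2 d3; rewrite !expr2; lra.
  have -> : D ^+ 2 = ((a0 - b0) ^+ 2 + (a1 - b1) ^+ 2) * ((c0 - a0) ^+ 2 + (c1 - a1) ^+ 2)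
     - ((b0 - a0) * (c0 - a0) + (b1 - a1) * (c1 - a1)) ^+ 2 by rewrite /D; ring.
  by rewrite d3 d2 uv; field.
have D0 : D != 0 by apply/eqP => D0; move: D2; rewrite D0 expr0n /=; lra.
have z0 : y0 = a0.
  apply/eqP; rewrite -subr_eq0; apply/eqP/(mulfI D0); rewrite mulr0 /D.
  transitivity ((c1 - a1) * ((b0 - a0) * (y0 - a0) + (b1 - a1) * (y1 - a1))
    - (b1 - a1) * ((c0 - a0) * (y0 - a0) + (c1 - a1) * (y1 - a1))); first by ring.
  by rewrite e1 e2 !mulr0 subrr.
have z1 : y1 = a1.
  apply/eqP; rewrite -subr_eq0; apply/eqP/(mulfI D0); rewrite mulr0 /D.
  transitivity ((b0 - a0) * ((c0 - a0) * (y0 - a0) + (c1 - a1) * (y1 - a1))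
    - (c0 - a0) * ((b0 - a0) * (y0 - a0) + (b1 - a1) * (y1 - a1))); first by ring.
  by rewrite e1 e2 !mulr0 subrr.
apply/rowP => c.
have [->|->] : c = ord0 \/ c = ord_max.
  by case: c => [[|[|]]//= ?]; [left|right]; apply: val_inj.
- exact: z0.
- exact: z1.
Qed.

End barycentric.

(** With the bound in telescoping form, [a n + D * rho ^+ n] decreases and [a n - D * rho ^+ n]
    increases, so limit and rate come from monotone convergence together. *)
Lemma geometric_cvg (R : realType) (a : nat -> R) (D rho : R) :
  0 <= D -> 0 < rho -> rho < 1 ->
  (forall n, `|a n.+1 - a n| <= D * (rho ^+ n - rho ^+ n.+1)) ->
  a n @[n --> \oo] --> limn a /\ forall n, `|limn a - a n| <= D * rho ^+ n.
Proof.
move=> D0 r0 r1 h.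
have geo : D * rho ^+ n @[n --> \oo] --> (0 : R).
  by apply: (@cvg_geometric R D rho); rewrite gtr0_norm.
have p n : 0 <= D * rho ^+ n by apply: mulr_ge0 => //; apply: exprn_ge0; exact: ltW.
pose up n := a n + D * rho ^+ n; pose dn n := a n - D * rho ^+ n.
have hup : nonincreasing_seq up.
  apply/nonincreasing_seqP => n; have := h n; rewrite /up ler_norml => /andP[_].
  by rewrite mulrBr; lra.
have hdn : nondecreasing_seq dn.
  apply/nondecreasing_seqP => n; have := h n; rewrite /dn ler_norml => /andP[+ _].
  by rewrite mulrBr; lra.
have cup : cvgn up.
  apply: nonincreasing_is_cvgn => //; exists (dn 0) => _ [n _ <-].
  apply: (le_trans (hdn 0 n (leq0n n))); rewrite /up /dn.
  by have := p n; lra.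
have ca : a n @[n --> \oo] --> limn up.
  have -> : a = fun n => up n - D * rho ^+ n by apply/funext => n; rewrite /up addrK.
  by rewrite -[limn up]subr0; apply: cvgB.
have la : limn a = limn up by exact/cvg_lim.
have ldn : dn n @[n --> \oo] --> limn a.
  by rewrite la -[limn up]subr0; apply: cvgB.
split; first by rewrite la.
move=> n; rewrite ler_norml; apply/andP; split.
  have qd : dn n <= limn a.
    by rewrite -(cvg_lim _ ldn)//; apply: nondecreasing_cvgn_le => //; apply/cvg_ex; exists (limn a).
  by move: qd; rewrite /dn; lra.
have qu : limn a <= up n by rewrite la; exact: nonincreasing_cvgn_ge.
by move: qu; rewrite /up; lra.
Qed.

Lemma Phiw_continuous (R : realType) (q : 'I_3 -> 'rV[R]_2) (w : seq 'I_3) :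
  continuous (Phiw q w).
Proof.
elim: w => [|i w IH] x; first exact: cvg_id.
apply: (@continuous_comp _ _ _ (Phiw q w) (Phi q i)); first exact: IH.
set y := Phiw q w x; rewrite /Phi.
apply: (@cvgD _ _ _ (nbhs y)); last exact: cvg_cst.
exact: scaler_continuous.
Qed.

Lemma dyadic_cell (R : realType) (n : nat) (t : R) : 0 <= t <= 1 ->
  exists k s, [/\ (k < 2 ^ n)%N, 0 <= s <= 1 & (k%:R + s) / 2 ^+ n = t].
Proof.
move=> /andP[t0 t1]; have pn : 0 < (2 : R) ^+ n by rewrite exprn_gt0.
have [->|tn1] := eqVneq t 1.
  exists (2 ^ n).-1, 1; split; first by rewrite prednK ?expn_gt0.
    by rewrite ler01 lexx.
  by rewrite natr1 prednK ?expn_gt0// natrX mulfV// gt_eqF.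
have t1' : t < 1 by rewrite lt_neqAle tn1.
have := @truncn_itv R (t * 2 ^+ n); rewrite mulr_ge0 ?(ltW pn)// => /(_ isT).
set k := Num.truncn _ => /andP[k1 k2]; exists k, (t * 2 ^+ n - k%:R); split.
- by rewrite -(ltr_nat R) (le_lt_trans k1)// natrX gtr_pMl.
- by rewrite -natr1 in k2; apply/andP; split; lra.
- by rewrite addrC subrK mulfK// gt_eqF.
Qed.

(** * Geometry of the attractor *)

Section attractor.
Variables (R : realType) (q : 'I_3 -> 'rV[R]_2).
Hypothesis hq : forall i j : 'I_3, i != j -> eucl_dist (q i) (q j) = 1.
Variable K : set 'rV[R]_2.
Hypotheses (hK : compact K) (hne : K !=set0)
  (hfix : K = \bigcup_(i in [set: 'I_3]) (Phi q i @` K)).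
Local Notation pt := 'rV[R]_2.
Local Notation Phi := (Phi q).
Local Notation Phiw := (Phiw q).
Local Notation bary := (bary R q).
Implicit Types (w v : seq 'I_3) (x y : pt).

Lemma K_Phi i x : K x -> K (Phi i x).
Proof. by move=> Kx; rewrite hfix; exists i => //; exists x. Qed.

Lemma K_Phiw w x : K x -> K (Phiw w x).
Proof. by move=> Kx; elim: w => //= i w; exact: K_Phi. Qed.

Lemma K_preimage x : K x -> exists iy : 'I_3 * pt, K iy.2 /\ Phi iy.1 iy.2 = x.
Proof. by rewrite {1}hfix => -[i _ [y Ky <-]]; exists (i, y). Qed.

Lemma Phi_inj i : injective (Phi i).
Proof.
by move=> x y /addIr /(scalerI (_ : 2^-1 != 0 :> R)); apply; rewrite invr_eq0.
Qed.

Lemma K_closed : closed K.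
Proof. by apply: compact_closed hK; exact: norm_hausdorff. Qed.

Lemma K_limit p : (forall e, 0 < e -> exists2 z, K z & `|p - z| < e) -> K p.
Proof.
move=> h; apply: contrapT => nKp.
have : open_nbhs p (~` K) by split => //; exact: closed_openC K_closed.
move=> /open_nbhs_nbhs/nbhs_ballP[e /= e0 he].
have [z Kz] := h e e0; rewrite -ball_normE in he => pz.
exact: (he z pz).
Qed.

(** Compactness gives some lower bound [- B]. Since [Phi i] at most halves a negative coordinate and
    adds a nonnegative shift, passing to preimages [n] times improves the bound to
    [- B / 2 ^+ n]. *)
Lemma bary_ge0 k x : K x -> 0 <= bary k x.
Proof.
have [B [B0 hB]] : exists B : R, 0 <= B /\ forall x, K x -> - B <= bary k x.
  have cb : continuous (bary k).
    have -> : bary k = fun x => 3^-1 + 2 *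
       ((x ord0 ord0 - (\sum_l q l ord0 ord0) / 3) * (q k ord0 ord0 - (\sum_l q l ord0 ord0) / 3) +
       (x ord0 ord_max - (\sum_l q l ord0 ord_max) / 3) * (q k ord0 ord_max - (\sum_l q l ord0 ord_max) / 3)).
      by apply/funext => z; exact: baryE.
    move=> y; have cc c : (fun x : pt => x ord0 c) x @[x --> y] --> y ord0 c by exact: coord_continuous.
    apply: (@cvgD _ _ _ (nbhs y)); first exact: cvg_cst.
    apply: (@cvgM _ _ (nbhs y)); first exact: cvg_cst.
    by apply: (@cvgD _ _ _ (nbhs y)); (apply: (@cvgM _ _ (nbhs y)); last exact: cvg_cst);
      (apply: (@cvgB _ _ _ (nbhs y)); last exact: cvg_cst); exact: cc.
  have [M [_ hM]] := compact_bounded (continuous_compact (continuous_subspaceT cb) hK).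
  exists (`|M| + 1); split; first by rewrite addr_ge0.
  move=> y Ky; have := hM (`|M| + 1) _ (bary k y).
  rewrite (le_lt_trans (ler_norm M)) ?ltrDl// => /(_ isT) h.
  have := h (ltac:(by exists y)); by rewrite /= ler_norml => /andP[].
move=> Kx; rewrite leNgt; apply/negP => neg.
have low n y : K y -> - B / 2 ^+ n <= bary k y.
  elim: n y => [|n IH] y Ky; first by rewrite divr1; exact: hB.
  have [[i z] /= [Kz <-]] := K_preimage _ Ky.
  rewrite (bary_Phi R q hq) exprS invfM mulrCA mulrC ler_wpM2r//.
  by rewrite (le_trans (IH _ Kz))// lerDl ler0n.
have d0 : 0 < - bary k x / (B + 1) by rewrite divr_gt0//; lra.
have [j hj] := dyadic_small _ _ d0.
have := low j x Kx; have := hj j (leqnn j).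
rewrite ltr_pdivlMr; last lra.
have : 0 < 2 ^- j :> R by rewrite invr_gt0 exprn_gt0.
nra.
Qed.

(** [q i] attracts the iterates of [Phi i] from any point of [K], and [K] is closed. *)
Lemma K_vertex i : K (q i).
Proof.
have [y Ky] := hne; apply: K_limit => e e0.
have d0 : 0 < e / (`|q i - y| + 1) by rewrite divr_gt0// ltr_wpDl.
have [n hn] := dyadic_small _ _ d0.
exists (Phiw (nseq n i) y); first exact: K_Phiw.
have -> : q i - Phiw (nseq n i) y = 2 ^- n *: (q i - y).
  elim: n {hn} => [|n IH]; first by rewrite invr1 scale1r.
  have -> : q i - Phiw (nseq n.+1 i) y = 2^-1 *: (q i - Phiw (nseq n i) y).
    by apply/rowP => c; rewrite !mxE; field.
  by rewrite IH scalerA exprS invfM.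
rewrite normrZ ger0_norm ?invr_ge0 ?exprn_ge0//.
have := hn n (leqnn n); rewrite ltr_pdivlMr ?ltr_wpDl//.
apply: le_lt_trans; apply: ler_wpM2l; first by rewrite invr_ge0 exprn_ge0.
by rewrite lerDl.
Qed.

Lemma K_side i j t : 0 <= t <= 1 -> K (side R q i j t).
Proof.
move=> /andP[t0 t1]; apply: K_limit => e e0.
have d0 : 0 < e / (`|q j - q i| + 1) by rewrite divr_gt0// ltr_wpDl.
have [n hn] := dyadic_small _ _ d0.
have [k [s [kn /andP[s0 s1] ts]]] := dyadic_cell R n t (ltac:(by rewrite t0 t1)).
have hk : `|t - k%:R / 2 ^+ n| <= 2 ^- n.
  have pn : 0 <= 2 ^- n :> R by rewrite invr_ge0 exprn_ge0.
  by rewrite -ts mulrDl addrC addKr ger0_norm ?mulr_ge0// ler_piMl.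
exists (Phiw (side_word i j n k) (q i)); first by apply/K_Phiw/K_vertex.
rewrite -[X in Phiw _ X](side0 R q i j) side_wordP// addr0 /side.
have -> : q i + t *: (q j - q i) - (q i + (k%:R / 2 ^+ n) *: (q j - q i)) =
  (t - k%:R / 2 ^+ n) *: (q j - q i) by apply/rowP => c; rewrite !mxE; ring.
rewrite normrZ; have := hn n (leqnn n); rewrite ltr_pdivlMr ?ltr_wpDl//.
apply: le_lt_trans; apply: ler_pM => //.
by rewrite lerDl.
Qed.

Let bary_le1 k x : K x -> bary k x <= 1.
Proof.
move=> Kx; rewrite -(bary_sum R q x) (bigD1 k)//= lerDl sumr_ge0// => l _.
exact: bary_ge0.
Qed.

Let bary_eq1 k x : K x -> bary k x = 1 -> x = q k.
Proof.
move=> Kx b1; apply: (bary_inj R q hq) => l; have [->//|lk] := eqVneq l k.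
have := bary_sum R q x; rewrite (bigD1 k)//= (bigD1 l)//= b1.
have h1 := bary_ge0 l x Kx.
have : 0 <= \sum_(i | (i != k) && (i != l)) bary i x.
  by apply: sumr_ge0 => i _; exact: bary_ge0.
by move=> h2 h3; apply/eqP; rewrite eq_le h1 andbT; move: h2 h3; lra.
Qed.

(** Comparing coordinate [a] gives [bary a x + 1 = bary a y]; as coordinates on [K] lie in [0, 1],
    [y] has coordinate 1 and is a vertex. Hence distinct subcells meet only in their shared
    midpoint. *)
Lemma Phi_overlap a b x y : a != b -> K x -> K y -> Phi a x = Phi b y -> x = q b /\ y = q a.
Proof.
move=> ab Kx Ky E.
have h k : bary k x + (k == a)%:R = bary k y + (k == b)%:R.
  have := congr1 (bary k) E; rewrite !(bary_Phi R q hq); lra.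
have ha := h a; have hb := h b; rewrite !eqxx (negbTE ab) eq_sym (negbTE ab) /= in ha hb.
have := bary_ge0 a x Kx; have := bary_ge0 b y Ky.
have := bary_le1 a y Ky; have := bary_le1 b x Kx => b1 b2 b3 b4.
split; apply: bary_eq1 => //; move: ha hb; rewrite ?mulr0n ?mulr1n; lra.
Qed.

(** A first letter [i] other than [b] would force the coordinate [i] to be at least 1 / 2, but it
    vanishes at [q b]. *)
Lemma Phiw_vertex w b x : K x -> Phiw w x = q b -> w = nseq (size w) b.
Proof.
move=> Kx; elim: w => //= i w IH E.
have Kw := K_Phiw w x Kx.
have ib : i = b.
  apply/eqP; apply: contraT => ib.
  have := bary_Phi R q hq i i (Phiw w x); rewrite E (bary_vertex R q hq) (negbTE ib) eqxx.
  have := bary_ge0 i _ Kw; rewrite ?mulr0n ?mulr1n; lra.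
rewrite ib -IH//; apply: (Phi_inj i); by rewrite E ib Phi_fix.
Qed.

Section address.
(* [nx x] consists of the first letter of an address of [x] and the preimage of [x]
   under the corresponding map. *)
Variable nx : pt -> 'I_3 * pt.
Hypothesis nxP : forall x, K x -> K (nx x).2 /\ Phi (nx x).1 (nx x).2 = x.

Fixpoint addr n x : seq 'I_3 := if n is n'.+1 then (nx x).1 :: addr n' (nx x).2 else [::].

Lemma size_addr n x : size (addr n x) = n.
Proof. by elim: n x => //= n IH x; rewrite IH. Qed.

Lemma addrP n x : K x -> exists2 y, K y & Phiw (addr n x) y = x.
Proof.
elim: n x => [|n IH] x Kx /=; first by exists x.
by have [Ky E] := nxP x Kx; have [y Kz E2] := IH _ Ky; exists y; rewrite //= E2.
Qed.

Lemma addrS n x : exists l, addr n.+1 x = rcons (addr n x) l.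
Proof.
elim: n x => [|n IH] x; first by exists (nx x).1.
by have [l El] := IH (nx x).2; exists l; rewrite [LHS]/= -/(addr n.+1 _) El.
Qed.

Section limit.
Variables (u : seq 'I_3 -> 'I_3 -> R) (B : R).
Hypotheses (cu : compatible R u) (uB : forall n, renergy R u n <= B).

Let rho : R := Num.sqrt (3 / 5).
Let c := Num.sqrt B.

Let rho2 : rho ^+ 2 = 3 / 5. Proof. by rewrite sqr_sqrtr//; lra. Qed.

Let rho0 : 0 < rho. Proof. by rewrite sqrtr_gt0; lra. Qed.

Let rho1 : rho < 1.
Proof. by rewrite -(@ltr_pXn2r _ 2)// ?nnegrE ?(ltW rho0)// rho2 expr1n; lra. Qed.

Let c0 : 0 <= c. Proof. exact: sqrtr_ge0. Qed.

(** The Hoelder estimate: bounded renormalized energy leaves a cell of level n a squared oscillation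
    of order (3 / 5)^n. *)
Let cell_osc w i j : `|u w i - u w j| <= c * rho ^+ size w.
Proof.
have := renergy_edge R u (size w) w i j erefl => /le_trans/(_ (uB _)) h.
have B0 : 0 <= B by apply: le_trans h; rewrite mulr_ge0 ?sqr_ge0// exprn_ge0//; lra.
rewrite -(@ler_pXn2r _ 2)// ?nnegrE ?mulr_ge0// ?exprn_ge0// ?(ltW rho0)//.
rewrite real_normK ?num_real// exprMn sqr_sqrtr// exprAC rho2.
have p : 0 < (5 / 3 : R) ^+ size w by apply: exprn_gt0; lra.
rewrite -(ler_pM2l p) (le_trans h)// mulrCA -exprMn.
by rewrite (_ : 5 / 3 * (3 / 5) = 1) ?expr1n ?mulr1//; field.
Qed.

(** Once the common prefix is removed, the two cells lie in different subcells, so they meet in the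
    shared midpoint and both remaining words are constant. Compatibility then identifies the values
    there. *)
Let common_vertex w w' y y' : size w = size w' -> K y -> K y' -> Phiw w y = Phiw w' y' ->
  exists a b, u w a = u w' b.
Proof.
move=> + Ky Ky'; elim: w w' u cu => [|l w IH] [|l' w'] //= u' cu'.
  by move=> _ _; exists ord0, ord0.
move=> [sw] E; have [ll|ll] := eqVneq l l'.
  rewrite -ll in E *.
  exact: (IH w' (fun v => u' (l :: v)) (compatible_sub R u' [:: l] cu') sw (Phi_inj _ _ _ E)).
have [E1 E2] := Phi_overlap l l' _ _ ll (K_Phiw w y Ky) (K_Phiw w' y' Ky') E.
rewrite (Phiw_vertex w l' y Ky E1) (Phiw_vertex w' l y' Ky' E2).
have [us ud] := cu'.
have tail a b n : u' (a :: nseq n b) b = u' [:: a] b.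
  elim: n => //= n IHn.
  have -> : a :: b :: nseq n b = rcons (a :: nseq n b) b.
    by rewrite rcons_cons -cats1 (_ : [:: b] = nseq 1 b)// -nseqD addn1.
  by rewrite ud.
by exists l', l; rewrite !tail (us [::]).
Qed.

Let D := 2 * c / (1 - rho).

Let seq_step x n : `|u (addr n.+1 x) ord0 - u (addr n x) ord0| <= D * (rho ^+ n - rho ^+ n.+1).
Proof.
have [l ->] := addrS n x.
have -> : D * (rho ^+ n - rho ^+ n.+1) = 2 * c * rho ^+ n.
  by rewrite exprS /D; field; move: rho1; lra.
rewrite (_ : _ - _ = (u (rcons (addr n x) l) ord0 - u (rcons (addr n x) l) l)
   + (u (addr n x) l - u (addr n x) ord0)); last by rewrite (proj2 cu); ring.
apply: le_trans (ler_normD _ _) _.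
have := cell_osc (addr n x) l ord0; rewrite size_addr.
have := cell_osc (rcons (addr n x) l) ord0 l; rewrite size_rcons size_addr exprS.
have p : 0 <= c * rho ^+ n by rewrite mulr_ge0// exprn_ge0// ltW.
have : c * (rho * rho ^+ n) <= c * rho ^+ n.
  by rewrite mulrCA ler_piMl// ltW.
lra.
Qed.

(** The corner [ord0] is arbitrary because oscillations tend to 0; [limit_cell] shows that the
    chosen address does not matter either. *)
Definition limit_fun x : R := limn (fun n => u (addr n x) ord0).

Let D0 : 0 <= D.
Proof. by rewrite divr_ge0 ?mulr_ge0// subr_ge0 ltW. Qed.

Lemma limit_cvg x : u (addr n x) ord0 @[n --> \oo] --> limit_fun x.
Proof. exact: (proj1 (geometric_cvg R _ D rho D0 rho0 rho1 (seq_step x))). Qed.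

Let limit_near x n : `|limit_fun x - u (addr n x) ord0| <= D * rho ^+ n.
Proof. exact: (proj2 (geometric_cvg R _ D rho D0 rho0 rho1 (seq_step x))). Qed.

Lemma limit_cell w y i : K y ->
  `|limit_fun (Phiw w y) - u w i| <= (D + 2 * c) * rho ^+ size w.
Proof.
move=> Ky; have [z Kz E] := addrP (size w) _ (K_Phiw w y Ky).
have [|a [b ab]] := common_vertex (addr (size w) (Phiw w y)) w z y _ Kz Ky E.
  by rewrite size_addr.
have := limit_near (Phiw w y) (size w).
have := cell_osc (addr (size w) (Phiw w y)) ord0 a; rewrite size_addr ab.
have := cell_osc w b i.
set s := size w; set v := u (addr _ _) _ => h1 h2 h3.
rewrite (_ : _ - _ = (limit_fun (Phiw w y) - v) + (v - u w b) + (u w b - u w i)); last by ring.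
apply: le_trans (ler_normD _ _) _; apply: le_trans (lerD (ler_normD _ _) (lexx _)) _.
by move: h1 h2 h3; lra.
Qed.

Let small e : 0 < e -> exists n, forall k, (n <= k)%N -> (D + 2 * c) * rho ^+ k <= e.
Proof.
move=> e0; have := @cvg_geometric R (D + 2 * c) rho.
rewrite gtr0_norm// => /(_ rho1)/cvgrPdist_le/(_ _ e0)[n _ hn].
exists n => k nk; have := hn k nk; rewrite sub0r normrN.
by apply: le_trans; exact: ler_norm.
Qed.

Lemma limit_eq p r : (forall e n, 0 < e -> exists v z i,
   [/\ (n <= size v)%N, K z, Phiw v z = p & `|u v i - r| <= e]) ->
  limit_fun p = r.
Proof.
move=> h; apply/eqP; rewrite -subr_eq0 -normr_le0; apply/ler_addgt0Pr => e e0.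
have e20 : 0 < e / 2 by rewrite divr_gt0.
have [n hn] := small _ e20; have [v [z [i [nv Kz <- hv]]]] := h _ n e20.
rewrite (_ : _ - _ = (limit_fun (Phiw v z) - u v i) + (u v i - r)); last by ring.
apply: le_trans (ler_normD _ _) _.
have := limit_cell v z i Kz; have := hn _ nv; move: hv; lra.
Qed.

Lemma limit_vertex w i : limit_fun (Phiw w (q i)) = u w i.
Proof.
apply: limit_eq => e n e0; exists (w ++ nseq n i), (q i), i; split.
- by rewrite size_cat size_nseq leq_addl.
- exact: K_vertex.
- by rewrite Phiw_cat; congr Phiw; elim: n => //= n ->; rewrite Phi_fix.
have -> : u (w ++ nseq n i) i = u w i.
  elim: n => [|n IH]; first by rewrite cats0.
  have -> : w ++ nseq n.+1 i = rcons (w ++ nseq n i) i.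
    by rewrite rcons_cat -cats1 (_ : [:: i] = nseq 1 i)// -nseqD addn1.
  by rewrite (proj2 cu).
by rewrite subrr normr0 ltW.
Qed.

Lemma limit_continuous : {within K, continuous limit_fun}.
Proof.
apply/subspace_continuousP => p Kp; apply/cvgrPdist_le => e e0.
have e20 : 0 < e / 2 by rewrite divr_gt0.
have [n hn] := small _ e20; rewrite near_withinE.
(* Near [p] only those cells of level [n] occur that contain [p]: the others are finitely many
   closed sets avoiding [p]. *)
have : \forall z \near p, forall w : n.-tuple 'I_3, (Phiw w @` K) z -> (Phiw w @` K) p.
  refine (@filter_forall pt (n.-tuple 'I_3)
    (fun (w : n.-tuple 'I_3) (z : pt) => (Phiw w @` K) z -> (Phiw w @` K) p) (nbhs p) _ _) => w.
  have [in_w|nin_w] := pselect ((Phiw w @` K) p); first by apply: nearW.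
  have cw : closed (Phiw w @` K).
    apply: compact_closed; first exact: norm_hausdorff.
    apply: continuous_compact hK; apply: continuous_subspaceT.
    exact: Phiw_continuous.
  have : open_nbhs p (~` (Phiw w @` K)) by split => //; exact: closed_openC.
  by move=> /open_nbhs_nbhs; apply: filterS => z /= nz /nz.
apply: filterS => z hz Kz.
have [y Ky Ey] := addrP n z Kz.
pose w := Tuple (introT eqP (size_addr n z)).
have [|x Kx Ex] := hz w; first by exists y.
have {}Ey : Phiw w y = z by exact: Ey.
rewrite -Ex -Ey; apply: le_trans (ler_distD (u w ord0) _ _) _.
rewrite [X in _ + X]distrC.
have := limit_cell w x ord0 Kx; have := limit_cell w y ord0 Ky.
by have := hn (size w); rewrite size_tuple leqnn => /(_ isT); lra.
Qed.

End limit.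
End address.
End attractor.

(** * Traces and extensions on the graph *)

Lemma within_continuous_comp (T : topologicalType) (R : realType) (A : set T)
    (F : T -> R) (h : R -> T) :
  {within A, continuous F} -> continuous h -> (forall x, A (h x)) -> continuous (F \o h).
Proof.
move=> /subspace_continuousP cF ch hA x.
apply: (@cvg_comp _ _ _ h F (nbhs x) (within A (nbhs (h x))) (nbhs (F (h x)))); last exact: cF.
move=> P; rewrite /within /= => nP.
have nh : nbhs x (fun y => A (h y) -> P (h y)) := ch x _ nP.
exact: (@filterS _ (nbhs x) _ (fun y => A (h y) -> P (h y)) (fun y => P (h y))
  (fun y Hy => Hy (hA y)) nh).
Qed.

Lemma sume_ge_term (R : realType) (I : finType) (P : pred I) (F : I -> \bar R) i :
  (forall i, (0 <= F i)%E) -> P i -> (F i <= \sum_(i | P i) F i)%E.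
Proof. by move=> F0 Pi; rewrite (bigD1 i)//= leeDl// sume_ge0. Qed.

Section graph.
Variables (R : realType) (q : 'I_3 -> 'rV[R]_2).
Local Notation pt := 'rV[R]_2.
Local Notation Phiw := (Phiw q).
Local Notation side := (side R q).
Implicit Types (f F : pt -> R) (w v : seq 'I_3) (i j : 'I_3).

Definition vertex_values f w i : R := f (Phiw w (q i)).

Lemma vertex_values_compatible f : compatible R (vertex_values f).
Proof.
by split=> [w i j|w i]; rewrite /vertex_values !Phiw_rcons ?Phi_fix// PhiC.
Qed.

Lemma renergy_vertex_values f n :
  renergy R (vertex_values f) n = (5 / 3) ^+ n * Em q n f.
Proof. by rewrite /renergy -wsumE. Qed.

Lemma energy_cvg f : ((renergy R (vertex_values f) n)%:E @[n --> \oo] --> energy q f)%E /\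
  forall n, ((renergy R (vertex_values f) n)%:E <= energy q f)%E.
Proof.
have -> : energy q f = limn (fun n => (renergy R (vertex_values f) n)%:E).
  by rewrite /energy; congr (limn _); apply/funext => n; rewrite renergy_vertex_values.
have nd : nondecreasing_seq (fun n => (renergy R (vertex_values f) n)%:E).
  by move=> a b ab; rewrite lee_fin renergy_nondecreasing//; exact: vertex_values_compatible.
have c := ereal_nondecreasing_cvgn nd.
rewrite (cvg_lim _ c)//; split=> // n; apply: ereal_sup_ubound; by exists n.
Qed.

Lemma energy_le f (B : R) : (forall n, renergy R (vertex_values f) n <= B) ->
  (energy q f <= B%:E)%E.
Proof.
move=> h; have [c _] := energy_cvg f; rewrite -(cvg_lim _ c)//.
apply: lime_le; first by apply/cvg_ex; eexists; exact: c.
by apply: nearW => n; rewrite lee_fin.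
Qed.

Variable m : nat.

(** Extends edge functions by constants, since the segment estimates are stated for functions
    continuous on the whole line. *)
Definition clamp (x : R) : R := Num.max 0 (Num.min x (2 ^- m)).

Lemma clamp_bounds x : 0 <= clamp x <= 2 ^- m.
Proof.
have L0 : 0 <= 2 ^- m :> R by rewrite invr_ge0 exprn_ge0.
by rewrite /clamp le_max lexx /= ge_max L0 ge_min lexx orbT.
Qed.

Lemma clamp_id x : 0 <= x <= 2 ^- m -> clamp x = x.
Proof. by move=> /andP[x0 x1]; rewrite /clamp min_l// max_r. Qed.

Lemma clamp_continuous : continuous clamp.
Proof.
have -> : clamp = (cst 0 \max (id \min cst (2 ^- m)))%R by apply/funext.
move=> x; apply: continuous_max; first exact: cst_continuous.
by apply: continuous_min; [exact: cvg_id | exact: cst_continuous].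
Qed.

Lemma edgeE w i j x : size w = m -> edge q w i j x = Phiw w (side i j (x * 2 ^+ m)).
Proof. by move=> sw; rewrite /edge /Ledge sw invrK. Qed.

Lemma edge_bounds (x : R) : 0 <= x <= 2 ^- m -> 0 <= x * 2 ^+ m <= 1.
Proof.
move=> /andP[x0 x1]; rewrite mulr_ge0 ?exprn_ge0//= -ler_pdivlMr ?exprn_gt0//.
by rewrite mul1r.
Qed.

Definition edge_fun F w i j (x : R) : R := F (edge q w i j (clamp x)).

Lemma edge_fun_continuous (A : set pt) F w i j : size w = m ->
  {within A, continuous F} -> (forall t, 0 <= t <= 1 -> A (Phiw w (side i j t))) ->
  continuous (edge_fun F w i j).
Proof.
move=> sw cF hA; apply: (@within_continuous_comp _ R A F (fun x => edge q w i j (clamp x))) => //.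
  move=> x; apply: (@continuous_comp _ _ _ clamp (edge q w i j)); first exact: clamp_continuous.
  set y := clamp x; rewrite /edge.
  apply: (@continuous_comp _ _ _ (fun x : R => q i + x / Ledge R (size w) *: (q j - q i)) (Phiw w)).
    apply: (@cvgD _ _ _ (nbhs y)); first exact: cvg_cst.
    apply: (@continuous_comp _ _ _ (fun x : R => x / Ledge R (size w)) (fun x : R => x *: (q j - q i))).
      by apply: (@cvgM _ _ (nbhs y)); [exact: cvg_id | exact: cvg_cst].
    exact: scalel_continuous.
  exact: Phiw_continuous.
by move=> x; rewrite edgeE//; apply/hA/edge_bounds/clamp_bounds.
Qed.

Lemma edge_fun_gpt F w i j n k : size w = m -> (k <= 2 ^ n)%N ->
  edge_fun F w i j (gpt (m + n) k) = F (Phiw w (side i j (k%:R / 2 ^+ n))).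
Proof.
move=> sw kn; have z : (2 : R) ^+ m != 0 by rewrite expf_neq0.
have z' : (2 : R) ^+ n != 0 by rewrite expf_neq0.
rewrite /edge_fun clamp_id.
  by rewrite edgeE//; congr (F (Phiw w (side i j _))); rewrite /gpt exprD; field; rewrite z z'.
rewrite /gpt divr_ge0 ?exprn_ge0//= exprD invfM mulrCA ler_piMr ?invr_ge0 ?exprn_ge0//.
by rewrite ler_pdivrMr ?exprn_gt0// mul1r -natrX ler_nat.
Qed.

Lemma edge_fun_sum F w i j N : size w = m ->
  \sum_(n < N) (5 / 3) ^+ n * \sum_(k < 2 ^ n)
    (edge_fun F w i j (gpt (m + n) k.+1) - edge_fun F w i j (gpt (m + n) k)) ^+ 2 =
  \sum_(n < N) side_sum R q (F \o Phiw w) i j n.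
Proof.
move=> sw; apply: eq_bigr => n _; congr (_ * _); apply: eq_bigr => k _.
by rewrite !edge_fun_gpt//; exact: ltnW.
Qed.

Let edge_norm F w i j : \bar R :=
  (\int[@lebesgue_measure R]_(x in `[0%R, Ledge R m]%classic)
    \int[@lebesgue_measure R]_(y in `[0%R, Ledge R m]%classic)
      ((F (edge q w i j x) - F (edge q w i j y)) ^+ 2 / (`|x - y| `^ (1 + 2 * beta R)))%:E)%E.

Let edge_normE F w i j : edge_norm F w i j = gagliardo R m (edge_fun F w i j).
Proof.
apply: eq_integral => x; rewrite inE /= in_itv /= => xL.
apply: eq_integral => y; rewrite inE /= in_itv /= => yL.
by rewrite /edge_fun !clamp_id.
Qed.

Let edge_norm_ge0 F w i j : (0 <= edge_norm F w i j)%E.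
Proof.
apply: integral_ge0 => x _; apply: integral_ge0 => y _.
by rewrite lee_fin divr_ge0 ?sqr_ge0 ?powR_ge0.
Qed.

Lemma gagliardo_le_hnorm F (w : m.-tuple 'I_3) i j : (i < j)%N ->
  (gagliardo R m (edge_fun F w i j) <= hnorm q m F)%E.
Proof.
move=> ij; rewrite -edge_normE.
have s0 (w' : m.-tuple 'I_3) i' : (0 <= \sum_(j' : 'I_3 | (i' < j')%N) edge_norm F w' i' j')%E.
  by apply: sume_ge0 => j' _; exact: edge_norm_ge0.
apply: (le_trans (sume_ge_term R _ (fun j' : 'I_3 => (i < j')%N) (edge_norm F w i) j (edge_norm_ge0 F w i) ij)).
apply: (le_trans (sume_ge_term R _ xpredT (fun i' : 'I_3 => \sum_(j' : 'I_3 | (i' < j')%N) edge_norm F w i' j')%E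
  i (s0 w) isT)).
apply: (sume_ge_term R _ xpredT (fun w' : m.-tuple 'I_3 =>
  \sum_(i' : 'I_3) \sum_(j' : 'I_3 | (i' < j')%N) edge_norm F w' i' j')%E w _ isT).
by move=> w'; apply: sume_ge0 => i' _; exact: s0.
Qed.

Lemma hnorm_le F (B : R) :
  (forall (w : m.-tuple 'I_3) i j, (i < j)%N -> (gagliardo R m (edge_fun F w i j) <= B%:E)%E) ->
  (hnorm q m F <= ((\sum_(w : m.-tuple 'I_3) \sum_(i : 'I_3) \sum_(j : 'I_3 | (i < j)%N) 1) * B)%:E)%E.
Proof.
move=> h; rewrite /hnorm mulr_suml -sumEFin; apply: lee_sum => w _.
rewrite mulr_suml -sumEFin; apply: lee_sum => i _.
rewrite mulr_suml -sumEFin; apply: lee_sum => j ij.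
by rewrite mul1r; have := h w i j ij; rewrite -edge_normE.
Qed.

(** The energy inside cell [w], times (5 / 3) to the length of [w], is part of the total; this
    factor is at least 1 and is dropped. *)
Lemma vertex_values_trace f w i j (B : R) : i != j -> (0 <= B) ->
  (forall n, renergy R (vertex_values f) n <= B) ->
  forall N, \sum_(n < N) side_sum R q (f \o Phiw w) i j n <= 225 * B.
Proof.
move=> ij B0 fB N.
have cu := compatible_sub R _ w (vertex_values_compatible f).
have := side_trace R (fun v => vertex_values f (w ++ v)) i j B cu ij _ N.
have uB n : renergy R (fun v => vertex_values f (w ++ v)) n <= B.
  apply: (le_trans _ (fB (size w + n)%N)).
  apply: (le_trans _ (renergy_sub R (vertex_values f) (size w) n w erefl)).
  rewrite ler_peMl//; last by apply: exprn_ege1; lra.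
  apply: mulr_ge0; first by apply: exprn_ge0; lra.
  by apply: wsum_ge0 => v; exact: tri_energy_ge0.
move=> /(_ uB); apply: le_trans.
rewrite le_eqVlt; apply/orP; left; apply/eqP.
apply: eq_bigr => n _; congr (_ * _); apply: eq_bigr => k _.
rewrite -sqrrN opprB /vertex_values !Phiw_cat /=.
by rewrite -(side1 R q i j) -(side0 R q i j) !side_wordP// addr0 natr1.
Qed.

Lemma SGm_side (w : m.-tuple 'I_3) i j t : 0 <= t <= 1 -> SGm q m (Phiw w (side i j t)).
Proof.
move=> /andP[t0 t1]; exists w, i, j, (t * 2 ^- m); split.
  rewrite /Ledge mulr_ge0 ?invr_ge0 ?exprn_ge0//=.
  by rewrite ler_piMl ?invr_ge0 ?exprn_ge0.
by rewrite edgeE ?size_tuple// divfK// expf_neq0.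
Qed.

(** Up to level [m] all vertices lie on the graph and keep their values; beyond it, each level [m]
    cell is filled in separately from its own sides. *)
Definition graph_ext f w j : R :=
  if (size w <= m)%N then f (Phiw w (q j))
  else uext R q (f \o Phiw (take m w)) (drop m w) j.

Lemma graph_extE f w v j : size w = m -> graph_ext f (w ++ v) j = uext R q (f \o Phiw w) v j.
Proof.
move=> sw; rewrite /graph_ext size_cat sw -[X in (_ <= X)%N]addn0 leq_add2l leqn0 size_eq0.
by case: eqP => [->|_]; rewrite ?cats0// take_size_cat ?drop_size_cat.
Qed.

Lemma graph_ext_compatible f : compatible R (graph_ext f).
Proof.
have low w j : (size w <= m)%N -> graph_ext f w j = f (Phiw w (q j)).
  by rewrite /graph_ext => ->.
have high w i j : (m <= size w)%N -> graph_ext f (rcons w i) j =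
    uext R q (f \o Phiw (take m w)) (rcons (drop m w) i) j.
  move=> mw; rewrite -{1}(cat_take_drop m w) rcons_cat graph_extE// size_take_min; lia.
split=> [w i j|w i]; case: (leqP m (size w)) => mw.
- by rewrite !high//; exact: (proj1 (uext_compatible R q _)).
- by rewrite !low ?size_rcons// !Phiw_rcons PhiC.
- rewrite high// (proj2 (uext_compatible R q _)).
  rewrite -[X in _ = graph_ext f X i](cat_take_drop m w) graph_extE// size_take_min; lia.
- by rewrite !low ?size_rcons// 1?ltnW// !Phiw_rcons Phi_fix.
Qed.

Lemma graph_extD f g (a b : R) w j :
  graph_ext (fun y => a * f y + b * g y) w j = a * graph_ext f w j + b * graph_ext g w j.
Proof. by rewrite /graph_ext; case: ifP => // _; rewrite -uextD. Qed.

Lemma SGm_vertex w i : (size w <= m)%N -> SGm q m (Phiw w (q i)).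
Proof.
move=> wm; pose v := w ++ nseq (m - size w) i.
have sv : size v == m by rewrite size_cat size_nseq subnKC.
have -> : Phiw w (q i) = Phiw (Tuple sv) (side i i 0).
  rewrite side0 /= Phiw_cat; congr (Phiw w _).
  by elim: (m - size w)%N => //= n <-; rewrite Phi_fix.
by apply: SGm_side; rewrite lexx ler01.
Qed.

Lemma eq_graph_ext f g w j : (forall x, SGm q m x -> f x = g x) ->
  graph_ext f w j = graph_ext g w j.
Proof.
move=> h; rewrite /graph_ext; case: leqP => wm; first exact/h/SGm_vertex.
apply: eq_uext => i' j' t t01 /=; apply: h.
have st : size (take m w) == m by rewrite size_take_min; lia.
exact: (SGm_side (Tuple st)).
Qed.

Lemma graph_ext_side f (w : m.-tuple 'I_3) v i j : on_side v i j ->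
  graph_ext f (w ++ v) i = f (Phiw w (Phiw v (q i))).
Proof. by move=> vij; rewrite graph_extE ?size_tuple// (uext_side R q _ v i j). Qed.

Definition ext_const : R := (5 / 3) ^+ m * wsum R m (fun=> (1 + (20 + 12 * (6 + 440))) * 4 *
   \sum_(i : 'I_3) \sum_(j : 'I_3 | (i < j)%N) 1).

Lemma graph_ext_const_ge0 : 0 <= ext_const.
Proof.
apply: mulr_ge0; first by apply: exprn_ge0; lra.
apply: wsum_ge0 => _; apply: mulr_ge0; first lra.
by apply: sumr_ge0 => i _; apply: sumr_ge0.
Qed.

(** By monotonicity it suffices to bound level [m + n], where the energy splits over the words of
    length [m] into those of the separate extensions. *)
Lemma graph_ext_energy f (B : R) :
  (forall (w : m.-tuple 'I_3) i j N, (i < j)%N ->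
     \sum_(n < N) side_sum R q (f \o Phiw w) i j n <= B) ->
  forall n, renergy R (graph_ext f) n <= ext_const * B.
Proof.
move=> fB n; apply: (le_trans (renergy_nondecreasing R _ (graph_ext_compatible f) n (m + n)%N (leq_addl _ _))).
have c53 k : 0 <= (5 / 3 : R) ^+ k by apply: exprn_ge0; lra.
rewrite /renergy /ext_const wsum_add exprD -!mulrA; apply: ler_wpM2l => //.
rewrite [leRHS]mulrC -!wsumZ; apply: le_wsum => w sw.
have sw' : size w == m by rewrite sw.
have -> : (5 / 3) ^+ n * wsum R n (fun v => tri_energy R (graph_ext f (w ++ v))) =
    renergy R (uext R q (f \o Phiw w)) n.
  congr (_ * _); apply: eq_wsum => v _; congr tri_energy; apply/funext => j.
  by rewrite graph_extE.
apply: le_trans (uext_energy R q (f \o Phiw w) n) _.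
rewrite [leRHS]mulrC -!mulrA; do 2 (apply: ler_wpM2l; first lra).
rewrite mulr_suml; apply: ler_sum => i _; rewrite mulr_suml; apply: ler_sum => j ij.
by rewrite mul1r; exact: (fB (Tuple sw')).
Qed.

End graph.

(** * The trace and extension operators *)

Section main.
Variables (R : realType) (q : 'I_3 -> 'rV[R]_2).
Hypothesis hq : forall i j : 'I_3, i != j -> eucl_dist (q i) (q j) = 1.
Variable K : set 'rV[R]_2.
Hypotheses (hK : compact K) (hne : K !=set0)
  (hfix : K = \bigcup_(i in [set: 'I_3]) (Phi q i @` K)).
Variable m : nat.
Local Notation pt := 'rV[R]_2.
Implicit Types (f F : pt -> R).

Lemma SGm_sub_K : SGm q m `<=` K.
Proof.
move=> p [w [i [j [x [xL ->]]]]]; rewrite (edgeE R q m) ?size_tuple//.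
by apply: (K_Phiw R q K hfix); apply: (K_side R q K hK hne hfix); exact: edge_bounds.
Qed.

Definition trace_const : R := (\sum_(w : m.-tuple 'I_3) \sum_(i : 'I_3) \sum_(j : 'I_3 | (i < j)%N) 1)
  * (4 ^- m * (20 / 3) ^+ m.+1 * 33 * 225).

Lemma trace_const_ge0 : 0 <= trace_const.
Proof.
apply: mulr_ge0.
  by apply: sumr_ge0 => w _; apply: sumr_ge0 => i _; apply: sumr_ge0.
apply: mulr_ge0; last by lra.
apply: mulr_ge0; last by lra.
by apply: mulr_ge0; [rewrite invr_ge0 exprn_ge0 | apply: exprn_ge0; lra].
Qed.

Lemma trace_bound F : in_dom q K F -> exists B, [/\ 0 <= B, energy q F = B%:E, inH q m F &
  (hnorm q m F <= (trace_const * B)%:E)%E].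
Proof.
move=> [cF eF]; have [_ le] := energy_cvg R q F.
have e0 : (0%:E <= energy q F)%E.
  apply: le_trans (le 0); rewrite lee_fin mulr_ge0//.
  by apply: wsum_ge0 => w; exact: tri_energy_ge0.
have EB : energy q F = (fine (energy q F))%:E.
  by rewrite fineK// fin_numE -ltey eF andbT gt_eqF// (lt_le_trans _ e0)// ltNyr.
set B := fine _ in EB; have B0 : 0 <= B by rewrite -lee_fin -EB.
have fB n : renergy R (vertex_values R q F) n <= B by rewrite -lee_fin -EB.
have hn : (hnorm q m F <= (trace_const * B)%:E)%E.
  rewrite /trace_const -[X in X%:E]mulrA; apply: (hnorm_le R q m) => w i j ij.
  have nij : i != j by apply: contraTneq ij => ->; rewrite ltnn.
  rewrite -[X in X%:E]mulrA; apply: gagliardo_upper.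
    apply: (edge_fun_continuous R q m K) => //; first by rewrite size_tuple.
    by move=> t t01; apply: (K_Phiw R q K hfix); apply: (K_side R q K hK hne hfix).
  by move=> N; rewrite edge_fun_sum ?size_tuple//; exact: vertex_values_trace.
exists B; split=> //; split; first exact: continuous_subspaceW SGm_sub_K cF.
by apply: (le_lt_trans hn); rewrite ltry.
Qed.

Variable nx : pt -> 'I_3 * pt.
Hypothesis nxP : forall x, K x -> K (nx x).2 /\ Phi q (nx x).1 (nx x).2 = x.

Definition extension f (x : pt) : R := limit_fun R nx (graph_ext R q m f) x.

Lemma graph_ext_bound f : inH q m f -> exists H, [/\ 0 <= H, hnorm q m f = H%:E &
  forall n, renergy R (graph_ext R q m f) n <= ext_const R m * (480 * (3 / 5) ^+ m * H)].
Proof.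
move=> [cf ef].
have h0 : (0%:E <= hnorm q m f)%E.
  apply: sume_ge0 => w _; apply: sume_ge0 => i _; apply: sume_ge0 => j _.
  apply: integral_ge0 => x _; apply: integral_ge0 => y _.
  by rewrite lee_fin divr_ge0 ?sqr_ge0 ?powR_ge0.
have EH : hnorm q m f = (fine (hnorm q m f))%:E.
  by rewrite fineK// fin_numE -ltey ef andbT gt_eqF// (lt_le_trans _ h0)// ltNyr.
set H := fine _ in EH; exists H; split=> //; first by rewrite -lee_fin -EH.
apply: graph_ext_energy => w i j N ij.
rewrite -(edge_fun_sum R q m) ?size_tuple//; apply: gagliardo_lower.
  apply: (edge_fun_continuous R q m (SGm q m)) => //; first by rewrite size_tuple.
  by move=> t t01; exact: SGm_side.
by rewrite -EH; exact: gagliardo_le_hnorm.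
Qed.

Let cp f := graph_ext_compatible R q m f.

Lemma extension_bound f : inH q m f -> exists H, [/\ 0 <= H, hnorm q m f = H%:E,
  in_dom q K (extension f) &
  (energy q (extension f) <= (ext_const R m * (480 * (3 / 5) ^+ m) * H)%:E)%E].
Proof.
move=> fH; have [H [H0 EH hB]] := graph_ext_bound f fH.
have en : (energy q (extension f) <= (ext_const R m * (480 * (3 / 5) ^+ m) * H)%:E)%E.
  apply: energy_le => n; rewrite -(mulrA (ext_const R m)).
  rewrite (_ : vertex_values R q (extension f) = graph_ext R q m f)//.
  apply/funext => w; apply/funext => i.
  exact: (limit_vertex R q hq K hK hne hfix nx nxP _ _ (cp f) hB).
exists H; split=> //; split; last by apply: (le_lt_trans en); rewrite ltry.
exact: (limit_continuous R q hq K hK hfix nx nxP _ _ (cp f) hB).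
Qed.

Lemma extension_on_graph f x : inH q m f -> SGm q m x -> extension f x = f x.
Proof.
move=> fH; have [H [H0 EH hB]] := graph_ext_bound f fH; have [cf _] := fH.
move=> [w [i [j [t [tL ->]]]]].
rewrite (edgeE R q m) ?size_tuple//; have := edge_bounds R m t tL.
move: (t * 2 ^+ m) => {tL}t /andP[t0 t1].
apply: (limit_eq R q hq K hK hfix nx nxP _ _ (cp f) hB) => e n e0.
have cg : continuous (edge_fun R q m f w i j).
  apply: (edge_fun_continuous R q m (SGm q m)) => //; first by rewrite size_tuple.
  by move=> s s01; exact: SGm_side.
have [dl dl0 hdl] := segment_unif_continuous R _ 0 (2 ^- m) e cg e0.
have [N0 hN0] := dyadic_small R dl dl0.
pose N := maxn n N0.
have [k [s [kN s01 ts]]] := dyadic_cell R N t (ltac:(by rewrite t0 t1)).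
(* The witness is the cell of level [m + N] along the edge that contains the point. Its corner [i]
   lies on the edge at arclength distance at most [2 ^- (m + N)], so uniform continuity of [f] along
   the edge applies. *)
exists (w ++ side_word i j N k), (side R q i j s), i; split.
- by rewrite size_cat size_side_word (leq_trans (leq_maxl n N0))// leq_addl.
- exact: (K_side R q K hK hne hfix).
- by rewrite Phiw_cat side_wordP// ts.
rewrite (graph_ext_side R q m f w _ i j (on_side_word i j N k)).
rewrite -(side0 R q i j) side_wordP// addr0.
have z : (2 : R) ^+ m != 0 by rewrite expf_neq0.
have tL : 0 <= t * 2 ^- m <= 2 ^- m.
  by rewrite mulr_ge0 ?invr_ge0 ?exprn_ge0//= ler_piMl ?invr_ge0 ?exprn_ge0.
have tE : f (Phiw q w (side R q i j t)) = edge_fun R q m f w i j (t * 2 ^- m).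
  by rewrite /edge_fun clamp_id// (edgeE R q m) ?size_tuple// divfK.
rewrite -(edge_fun_gpt R q m) ?size_tuple ?(ltnW kN)// tE distrC.
apply/ltW/hdl.
  by rewrite inE /= in_itv.
apply: (le_lt_trans _ (hN0 (m + N)%N _)); last first.
  by rewrite (leq_trans (leq_maxr n N0))// leq_addl.
move: s01 => /andP[s0 s1].
have -> : t * 2 ^- m - gpt (m + N) k = s * 2 ^- (m + N).
  rewrite /gpt -ts !exprD; have z' : (2 : R) ^+ N != 0 by rewrite expf_neq0.
  by field; rewrite z z'.
have p : 0 <= 2 ^- (m + N) :> R by rewrite invr_ge0 exprn_ge0.
by rewrite ger0_norm ?mulr_ge0// ler_piMl.
Qed.

Lemma eq_extension f g x : (forall x, SGm q m x -> f x = g x) -> extension f x = extension g x.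
Proof.
move=> fg; rewrite /extension /limit_fun; congr (limn _); apply/funext => n.
exact: eq_graph_ext.
Qed.

(** Vertex values are linear in the data by construction; the finite norms ensure that both limits
    along the address exist. *)
Lemma extensionD (a b : R) f g x : inH q m f -> inH q m g ->
  extension (fun y => a * f y + b * g y) x = a * extension f x + b * extension g x.
Proof.
move=> fH gH; have [Hf [_ _ hf]] := graph_ext_bound f fH.
have [Hg [_ _ hg]] := graph_ext_bound g gH.
have cf := limit_cvg R nx _ _ (cp f) hf x; have cg := limit_cvg R nx _ _ (cp g) hg x.
rewrite {1}/extension /limit_fun; under eq_fun do rewrite graph_extD.
apply/cvg_lim => //; apply: cvgD; apply: cvgM => //; exact: cvg_cst.
Qed.

End main.

Theorem theorem5p2 (R : realType) (q : 'I_3 -> 'rV[R]_2)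
  (hq : forall i j : 'I_3, i != j -> eucl_dist (q i) (q j) = 1)
  (K : set 'rV[R]_2) (hK : compact K) (hne : K !=set0)
  (hfix : K = \bigcup_(i in [set: 'I_3]) (Phi q i @` K))
  (m : nat) :
  exists c : R, 0 < c /\
    (forall F : 'rV[R]_2 -> R, in_dom q K F ->
       inH q m F /\ (hnorm q m F <= c%:E * energy q F)%E) /\
    exists Ext : ('rV[R]_2 -> R) -> ('rV[R]_2 -> R),
      (forall f, inH q m f ->
         [/\ in_dom q K (Ext f),
             (forall x, SGm q m x -> Ext f x = f x) &
             (energy q (Ext f) <= c%:E * hnorm q m f)%E]) /\
      (forall f g, inH q m f -> inH q m g ->
         (forall x, SGm q m x -> f x = g x) ->
         forall x, K x -> Ext f x = Ext g x) /\
      (forall (a b : R) f g, inH q m f -> inH q m g ->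
         forall x, K x ->
           Ext (fun y => a * f y + b * g y) x = a * Ext f x + b * Ext g x).
Proof.
have [nx nxP] : exists nx : 'rV[R]_2 -> 'I_3 * 'rV[R]_2,
    forall x, K x -> K (nx x).2 /\ Phi q (nx x).1 (nx x).2 = x.
  have [nx nxP] : {nx : 'rV[R]_2 -> 'I_3 * 'rV[R]_2 &
      forall x, K x -> K (nx x).2 /\ Phi q (nx x).1 (nx x).2 = x}.
    (* Outside [K] the pair [(ord0, x)] is a default value. *)
    apply: (@choice _ _ (fun x iy => K x -> K iy.2 /\ Phi q iy.1 iy.2 = x)) => x; have [Kx|nKx] := pselect (K x); last by exists (ord0, x).
    by have [iy h] := K_preimage R q K hfix x Kx; exists iy.
  by exists nx.
have c10 := trace_const_ge0 R m.
pose c2 := ext_const R m * (480 * (3 / 5) ^+ m).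
have c20 : 0 <= c2.
  apply: mulr_ge0; first exact: graph_ext_const_ge0.
  by apply: mulr_ge0; [exact: ler0n | apply: exprn_ge0; lra].
(* One constant serves both inequalities; the summand 1 makes it strictly positive. *)
exists (trace_const R m + c2 + 1); split; first by apply: ltr_wpDl => //; exact: addr_ge0.
split=> [F FD|].
  have [B [B0 EB FH hB]] := trace_bound R q K hK hne hfix m F FD.
  split=> //; rewrite EB -EFinM; apply: (le_trans hB); rewrite lee_fin ler_wpM2r//.
  by rewrite -addrA lerDl addr_ge0.
exists (extension R q m nx); split=> [f fH|].
  have [H [H0 EH fD en]] := extension_bound R q hq K hK hne hfix m nx nxP f fH.
  split=> //; first by move=> x; exact: (extension_on_graph R q hq K hK hne hfix m nx nxP).
  rewrite EH -EFinM; apply: (le_trans en); rewrite lee_fin ler_wpM2r//.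
  by rewrite -/c2 addrAC lerDr addr_ge0.
split=> [f g fH gH fg x _|a b f g fH gH x _]; first exact: eq_extension.
exact: extensionD.
Qed.
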